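(* Suppose that $\{\psi_{ijk}^{\prime h}\}$ and $\{\psi_{ijk}^{\prime\prime h}\}$ tend to zero uniformly as $h\to0$. Then $$\inf_{f\in\mathcal F}\mathcal E_D(f)=\lim_{h\to0}\min_{f\in\mathcal F}\mathcal E_D^h(f).$$
   Context: $\mathcal M$ is a smooth simple surface embedded in $\mathbb{R}^m$ with $m\ge2$, parameterized as $\mathcal M=\{\mathbf{x}(\omega):\omega\in\Omega\}$, $\Omega\subset\mathbb{R}^2$, with $\nabla\mathbf{x}(\omega)\in\mathbb{R}^{m\times2}$ the matrix of partial derivatives, of full column rank and Lipschitz: $\|\nabla\mathbf{x}(\omega)-\nabla\mathbf{x}(\omega')\|_F\le C_{\mathcal M}\|\omega-\omega'\|$ on $\Omega$. $\sigma_{\max}=\max_{\omega\in\Omega}\|\nabla\mathbf{x}(\omega)\|_F$ and $\sigma_{\min}=\min_{\omega\in\Omega}\sigma_{\min}(\nabla\mathbf{x}(\omega))$, where $\sigma_{\min}(\cdot)$ of a matrix is its smallest singular value. A mesh is a partition of $\Omega$, without overlaps, into finitely many nondegenerate triangles $\Omega_{ijk}$ with vertices $\omega_i,\omega_j,\omega_k$ and area $T_{ijk}$; $\mathcal M_{ijk}=\{\mathbf{x}(\omega):\omega\in\Omega_{ijk}\}$; $v_\ell=\mathbf{x}(\omega_\ell)$; $V_{ijk}$ is the triangle with vertices $v_i,v_j,v_k$, assumed nondegenerate, with area $A_{ijk}$; $v_{ij}=v_i-v_j$, $v_{jk}=v_j-v_k$, $v_{ki}=v_k-v_i$; $d(\cdot)$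 is the diameter (longest side length) of a triangle. The mesh sizes are $h_\Omega=\max d(\Omega_{ijk})$ and $h_V=\max d(V_{ijk})$; one considers a family of meshes, and $h\to0$ means $h_\Omega\to0$ or, equivalently, $h_V\to0$. $\mathbf{n}_{ijk}$ is the unit normal vector of the plane of $V_{ijk}$ in a right-hand system, with $v_{ij}\times v_{jk}=2A_{ijk}\mathbf{n}_{ijk}$, where $\times$ is the exterior (cross) product, and $b_{ijk}=[b_i,b_j,b_k]=\frac{1}{2A_{ijk}}[v_{jk}\times\mathbf{n}_{ijk},\,v_{ki}\times\mathbf{n}_{ijk},\,v_{ij}\times\mathbf{n}_{ijk}]\in\mathbb{R}^{m\times3}$; thus the barycentric coordinates of a point $p$ of the plane of $V_{ijk}$ are $\langle b_i,p-v_j\rangle$, $\langle b_j,p-v_k\rangle$, $\langle b_k,p-v_i\rangle$, and $b_{ijk}^\top\mathbf{n}_{ijk}=0$. For $f:\mathcal M\to\mathbb{R}^n$, $\nabla_{\mathcal M}f(\mathbf{x})=\nabla(f\circ\mathbf{x})(\nabla\mathbf{x}^\top\nabla\mathbf{x})^{-1}\nabla\mathbf{x}^\top\in\mathbb{R}^{n\times m}$ is the tangential gradient, where $\nabla(f\circ\mathbf{x})$ is the Jacobian of $\omega\mapsto f(\mathbf{x}(\omega))$, and $c_L(f)$ is the Lipschitz constant of $\nabla_{\mathcal M}f$: $\|\nabla_{\mathcal M}f(\mathbf{x})-\nabla_{\mathcal M}f(\hat{\mathbf{x}})\|_F\le c_L(f)\|\mathbf{x}-\hat{\mathbf{x}}\|$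 on $\mathcal M$. For a given target surface $\mathcal N\subset\mathbb{R}^n$ and a positive constant $C_L$, $$\mathcal F=\{f:\ f(\mathcal M)=\mathcal N,\ c_L(f)\le C_L\}.$$ The Dirichlet energy and its discretization are $$\mathcal E_D(f)=\frac12\int_{\mathcal M}\|\nabla_{\mathcal M}f\|_F^2\,d\sigma,\qquad\mathcal E_D^h(f)=\sum_{\mathcal M_{ijk}}\frac12\int_{\mathcal M_{ijk}}\|f_{ijk}b_{ijk}^\top\|_F^2\,d\sigma,\quad f_{ijk}=[f(v_i),f(v_j),f(v_k)],$$ with $d\sigma$ the surface area element and $\|\cdot\|_F$ the Frobenius norm. For each mesh and each of its triangles, $$\psi_{ijk}^{\prime h}=\frac{3C_{\mathcal M}d(V_{ijk})d^2(\Omega_{ijk})}{A_{ijk}}+\Big(\frac{3C_{\mathcal M}d^3(\Omega_{ijk})}{\sigma_{\min}T_{ijk}}\Big)^2,\qquad\psi_{ijk}^{\prime\prime h}=\frac{3C_L\sigma_{\max}^2d(V_{ijk})d^2(\Omega_{ijk})}{2A_{ijk}}.$$ *)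

(* Defs.v *)
From HB Require Import structures.
From mathcomp Require Import all_boot all_order all_algebra.
From mathcomp Require Import all_classical all_reals all_analysis.
From mathcomp Require Import ring.

Set Implicit Arguments.
Unset Strict Implicit.
Unset Printing Implicit Defensive.

Import Order.TTheory GRing.Theory Num.Theory.
Import numFieldNormedType.Exports.

Local Open Scope classical_set_scope.
Local Open Scope ring_scope.

(* Vectors are columns.  The library norm on matrices is the sup norm, so the
   Frobenius (for columns: Euclidean) norm is introduced separately. *)
Definition frob (R : realType) (m n : nat) (A : 'M[R]_(m, n)) : R :=
  Num.sqrt (\sum_i \sum_j A i j ^+ 2).

Definition dotp (R : realType) (m : nat) (u v : 'cV[R]_m) : R :=
  (u^T *m v) 0 0.

Definition singular_value (R : realType) (m n : nat) (A : 'M[R]_(m, n)) (s : R)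
    : Prop :=
  0 <= s /\ eigenvalue (A^T *m A) (s ^+ 2).

(* For n <= m, the eigenvalues of A^T A give all singular values of A. *)
Definition min_singular_value (R : realType) (m n : nat) (A : 'M[R]_(m, n))
    : R :=
  inf [set s | singular_value A s].

(* Triangles in R^d: the vertices i, j, k are indexed by 0, 1, 2 in 'I_3, whose
   addition is cyclic. *)
Definition triangle_of (R : realType) (d : nat) := 'I_3 -> 'cV[R]_d.

Section Triangle.
Variables (R : realType) (d : nat).
Implicit Types (p : triangle_of R d) (u v w : 'cV[R]_d).

Definition hull p : set 'cV[R]_d :=
  [set w | exists t : 'I_3 -> R,
    [/\ forall a, 0 <= t a, \sum_a t a = 1 & w = \sum_a t a *: p a]].

(* side p 0, side p 1, side p 2 are v_ij, v_jk, v_ki. *)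
Definition side p (a : 'I_3) : 'cV[R]_d := p a - p (a + 1).

Definition diam p : R := \big[Num.max/0]_(a < 3) frob (side p a).

Definition area p : R :=
  Num.sqrt (dotp (side p 0) (side p 0) * dotp (side p 1) (side p 1)
            - dotp (side p 0) (side p 1) ^+ 2) / 2.

Definition nondeg_tri p : Prop := 0 < area p.

(* The exterior product of two vectors of R^d is the bivector v /\ w, encoded
   as a skew-symmetric matrix; the product of a vector u by a bivector B is the
   contraction B u.  In R^3, identifying v /\ w with the vector v x w, the
   latter is u x (v x w), see crossb_extprodE. *)
Definition extprod v w : 'M[R]_d := v *m w^T - w *m v^T.
Definition crossb u (B : 'M[R]_d) : 'cV[R]_d := B *m u.

Definition unit_normal p : 'M[R]_d :=
  (2 * area p)^-1 *: extprod (side p 0) (side p 1).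

Definition bary_vec p (a : 'I_3) : 'cV[R]_d :=
  (2 * area p)^-1 *: crossb (side p (a + 1)) (unit_normal p).

Definition bary_mx p : 'M[R]_(d, 3) := \matrix_(r, a) bary_vec p a r 0.

End Triangle.

Definition cross3 (R : realType) (u v : 'cV[R]_3) : 'cV[R]_3 :=
  \col_i (u (i + 1) 0 * v (i + 2) 0 - u (i + 2) 0 * v (i + 1) 0).

Lemma crossb_extprodE (R : realType) (u v w : 'cV[R]_3) :
  crossb u (extprod v w) = cross3 u (cross3 v w).
Proof.
have sum3 (F : 'I_3 -> R) i : \sum_a F a = F i + F (i + 1) + F (i + 2).
  have F0 j k : val j = val k -> F j = F k by move/val_inj ->.
  rewrite !big_ord_recl big_ord0 addr0.
  case: i => [[|[|[|//]]] Hi].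
  - by rewrite addrA; congr (_ + _ + _); exact: F0.
  - by rewrite addrC; congr (_ + _ + _); exact: F0.
  - by rewrite addrA addrC addrA; congr (_ + _ + _); exact: F0.
apply/colP => i; rewrite /crossb /extprod mxE (sum3 _ i) !mxE !big_ord1 !mxE.
have -> : i + 1 + 1 = i + 2 by rewrite -addrA.
have -> : i + 1 + 2 = i by rewrite -[RHS]addr0 -addrA; congr (_ + _); apply/val_inj.
have -> : i + 2 + 1 = i by rewrite -[RHS]addr0 -addrA; congr (_ + _); apply/val_inj.
have -> : i + 2 + 2 = i + 1 by rewrite -addrA; congr (_ + _); apply/val_inj.
ring.
Qed.

(* The pairing with bary_vec p a gives the barycentric coordinate of index a. *)
Lemma dotp_bary_vec (R : realType) (d : nat) (p : triangle_of R d) (a b : 'I_3) :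
  nondeg_tri p -> dotp (bary_vec p a) (p b - p (a + 1)) = (a == b)%:R.
Proof.
have dotpDr u v w : dotp u (v + w) = dotp u v + dotp u w :> R.
  by rewrite /dotp mulmxDr mxE.
have dotpC (u v : 'cV[R]_d) : dotp u v = dotp v u.
  by rewrite /dotp -[v]trmxK -trmx_mul mxE trmxK.
have dotpNr (u v : 'cV[R]_d) : dotp u (- v) = - dotp u v.
  by rewrite /dotp mulmxN mxE.
have dotpZl (k : R) (u v : 'cV[R]_d) : dotp (k *: u) v = k * dotp u v.
  by rewrite /dotp linearZ /= -scalemxAl mxE.
pose s := side p 0; pose t := side p 1.
have dotW u v : dotp (extprod s t *m u) v
    = dotp t u * dotp s v - dotp s u * dotp t v.
  have mulE (y z w : 'cV[R]_d) : dotp (y *m z^T *m w) v = dotp z w * dotp y v.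
    by rewrite /dotp -mulmxA trmx_mul -mulmxA mxE big_ord1 mxE.
  rewrite mulmxBl dotpC dotpDr dotpNr ![dotp v _]dotpC.
  by rewrite !mulE.
rewrite /nondeg_tri => A_gt0; set A := area p in A_gt0.
have A4 : dotp s s * dotp t t - dotp s t ^+ 2 = (2 * A) ^+ 2.
  have G : 0 < dotp s s * dotp t t - dotp s t ^+ 2.
    by rewrite -sqrtr_gt0; move: A_gt0; rewrite /A /area pmulr_lgt0 ?invr_gt0.
  have -> : 2 * A = Num.sqrt (dotp s s * dotp t t - dotp s t ^+ 2).
    by rewrite /A /area -/s -/t mulrC divfK ?pnatr_eq0.
  by rewrite sqr_sqrtr// ltW.
rewrite /bary_vec /crossb /unit_normal dotpZl -scalemxAl dotpZl dotW.
have side2 : side p (1 + 1) = - (s + t).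
  rewrite /s /t /side (_ : 1 + 1 + 1 = 0 :> 'I_3); last exact/val_inj.
  by rewrite add0r addrA subrK opprB.
have A0 : (2 * A) ^+ 2 != 0 by rewrite expf_neq0// mulf_neq0// ?pnatr_eq0 ?gt_eqF.
rewrite mulrA -invfM -expr2.
have nz c k : c = k * (2 * A) ^+ 2 -> ((2 * A) ^+ 2)^-1 * c = k.
  by move=> ->; rewrite mulrC mulfK.
apply: nz; rewrite -A4.
have -> : p b - p (a + 1) = if b == a then side p a else
                            if b == a + 1 then 0 else - side p (a + 1).
  case: eqP => [->//|/eqP ba]; case: eqP => [->|/eqP ba1]; first exact: subrr.
  rewrite /side opprB (_ : b = a + 1 + 1)//; apply/val_inj; move: ba ba1.
  by do [case: a => [[|[|[|//]]] ?]]; case: b => [[|[|[|//]]] ?].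
have I3 (P : 'I_3 -> Prop) : P 0 -> P 1 -> P (1 + 1) -> forall c, P c.
  move=> P0 P1 P2 [[|[|[|//]]] Hc].
  - by rewrite (_ : Ordinal Hc = 0)//; exact/val_inj.
  - by rewrite (_ : Ordinal Hc = 1)//; exact/val_inj.
  - by rewrite (_ : Ordinal Hc = 1 + 1)//; exact/val_inj.
have t110 : 1 + 1 + 1 = 0 :> 'I_3 by exact/val_inj.
have dotp0r (u : 'cV[R]_d) : dotp u 0 = 0 by rewrite /dotp mulmx0 mxE.
have dotDl (u v w : 'cV[R]_d) : dotp (u + v) w = dotp u w + dotp v w.
  by rewrite dotpC dotpDr ![dotp w _]dotpC.
have dotNl (u v : 'cV[R]_d) : dotp (- u) v = - dotp u v by rewrite dotpC dotpNr dotpC.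
have [side0 side1] : side p 0 = s /\ side p 1 = t by [].
clearbody s t; rewrite [a == b]eq_sym.
case: eqP => [_|_]; last case: eqP => _; rewrite ?mul1r ?mul0r ?dotp0r.
- move: a; apply: I3; rewrite ?add0r ?t110 ?side2 ?side0 ?side1;
    rewrite ?(dotpDr, dotDl, dotpNr, dotNl) ?(dotpC t s); ring.
- by rewrite !mulr0 subrr.
- move: a; apply: I3; rewrite ?add0r ?t110 ?side2 ?side0 ?side1;
    rewrite ?(dotpDr, dotDl, dotpNr, dotNl) ?(dotpC t s); ring.
Qed.

(* Meshes of Om; the triangles are closed, and only their interiors are
   disjoint. *)
Record mesh (R : realType) (Om : set 'cV[R]_2) := Mesh {
  ntri : nat;
  tri : 'I_ntri -> triangle_of R 2;
  tri_nondeg : forall t, nondeg_tri (tri t);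
  tri_cover : \bigcup_t hull (tri t) = Om;
  tri_nooverlap : forall s t, s != t ->
    interior (hull (tri s)) `&` interior (hull (tri t)) = set0
}.
Arguments ntri {R Om} K : rename.
Arguments tri {R Om} K t : rename.

Definition mesh_size (R : realType) (Om : set 'cV[R]_2) (K : mesh Om) : R :=
  \big[Num.max/0]_(t < ntri K) diam (tri K t).

(* The filter "h -> 0" on the index set of a family of meshes. *)
Definition h_to_0 (R : realType) (Om : set 'cV[R]_2) (I : Type)
    (K : I -> mesh Om) : set_system I :=
  filter_from [set e : R | 0 < e] (fun e => [set i | mesh_size (K i) < e]).

Global Instance h_to_0_filter (R : realType) (Om : set 'cV[R]_2) (I : Type)
  (K : I -> mesh Om) : Filter (h_to_0 K).
Proof.
apply: filter_from_filter; first by exists 1 => /=.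
move=> e1 e2 /= e1_gt0 e2_gt0; exists (Num.min e1 e2).
  by rewrite /= lt_min e1_gt0.
by move=> i /=; rewrite lt_min => /andP[].
Qed.

Definition unif_to_0 (R : realType) (Om : set 'cV[R]_2) (I : Type)
    (K : I -> mesh Om) (psi : triangle_of R 2 -> R) : Prop :=
  forall e : R, 0 < e ->
    \forall i \near h_to_0 K, forall t, `|psi (tri (K i) t)| < e.

Section Surface.
Variables (R : realType) (Om : set 'cV[R]_2).

(* J is the Jacobian matrix at w of the restriction of g to Om: one-sided at
   boundary points, and insensitive to the values of g outside Om. *)
Definition is_jacobian (d : nat) (g : 'cV[R]_2 -> 'cV[R]_d) (w : 'cV[R]_2)
    (J : 'M[R]_(d, 2)) : Prop :=
  forall e : R, 0 < e -> \forall w' \near within Om (nbhs w),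
    frob (g w' - g w - J *m (w' - w)) <= e * frob (w' - w).

Definition differentiable_in (d : nat) (g : 'cV[R]_2 -> 'cV[R]_d) : Prop :=
  forall w, Om w -> exists J, is_jacobian g w J.

Definition jacobian_in (d : nat) (g : 'cV[R]_2 -> 'cV[R]_d) (w : 'cV[R]_2)
    : 'M[R]_(d, 2) :=
  xget 0 [set J | is_jacobian g w J].

Variables (m n : nat) (x : 'cV[R]_2 -> 'cV[R]_m).
Implicit Types (f : 'cV[R]_m -> 'cV[R]_n) (N : set 'cV[R]_n).

Definition simple_surface (CM : R) : Prop :=
  [/\ set_inj Om x,
      differentiable_in x,
      forall w, Om w -> \rank (jacobian_in x w) = 2%N
    & forall w w', Om w -> Om w' ->
        frob (jacobian_in x w - jacobian_in x w') <= CM * frob (w - w')].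

Definition sigma_max : R := sup [set frob (jacobian_in x w) | w in Om].
Definition sigma_min : R :=
  inf [set min_singular_value (jacobian_in x w) | w in Om].

Definition lift_tri (p : triangle_of R 2) : triangle_of R m := fun a => x (p a).

Definition param (z : R * R) : 'cV[R]_2 := \col_i (if i == 0 then z.1 else z.2).

Definition area_element (w : 'cV[R]_2) : R :=
  Num.sqrt (\det ((jacobian_in x w)^T *m jacobian_in x w)).

(* g w is the value of the integrand at the point x w of the surface, and the
   integral is over the image of D. *)
Definition surface_integral (D : set 'cV[R]_2) (g : 'cV[R]_2 -> R) : \bar R :=
  (\int[lebesgue_measure \x lebesgue_measure]_(z in param @^-1` D)
     (g (param z) * area_element (param z))%:E)%E.

(* The tangential gradient of f at the point x w; only the values of f on the
   surface matter. *)
Definition tgrad f (w : 'cV[R]_2) : 'M[R]_(n, m) :=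
  jacobian_in (f \o x) w *m
    invmx ((jacobian_in x w)^T *m jacobian_in x w) *m (jacobian_in x w)^T.

Definition lip_tgrad f : \bar R :=
  ereal_inf [set c%:E | c in [set c : R | 0 <= c /\
    forall w w', Om w -> Om w' ->
      frob (tgrad f w - tgrad f w') <= c * frob (x w - x w')]].

Definition admissible N (CL : R) : set ('cV[R]_m -> 'cV[R]_n) :=
  [set f : 'cV[R]_m -> 'cV[R]_n |
    [/\ differentiable_in (f \o x),
        f @` (x @` Om) = N
      & (lip_tgrad f <= CL%:E)%E]].

Definition dirichlet f : \bar R :=
  ((2^-1)%:E * surface_integral Om (fun w => frob (tgrad f w) ^+ 2)%R)%E.

Definition vertex_values f (v : triangle_of R m) : 'M[R]_(n, 3) :=
  \matrix_(r, a) f (v a) r 0.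

Definition discrete_dirichlet (K : mesh Om) f : \bar R :=
  (\sum_(t < ntri K) (2^-1)%:E *
     let v := lift_tri (tri K t) in
     surface_integral (hull (tri K t))
       (fun=> frob (vertex_values f v *m (bary_mx v)^T) ^+ 2)%R)%E.

Definition psi' (CM : R) (p : triangle_of R 2) : R :=
  3 * CM * diam (lift_tri p) * diam p ^+ 2 / area (lift_tri p)
  + (3 * CM * diam p ^+ 3 / (sigma_min * area p)) ^+ 2.

Definition psi'' (CL : R) (p : triangle_of R 2) : R :=
  3 * CL * sigma_max ^+ 2 * diam (lift_tri p) * diam p ^+ 2
  / (2 * area (lift_tri p)).

End Surface.

Definition is_minimum (R : realType) (A : set (\bar R)) (y : \bar R) : Prop :=
  A y /\ lbound A y.

(* Main.v *)
Require Import Defs.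
From mathcomp Require Import all_boot all_order all_algebra.
From mathcomp Require Import all_classical all_reals all_analysis.
From mathcomp Require Import perm measurable_realfun.
From mathcomp Require Import ring lra.

Set Implicit Arguments.
Unset Strict Implicit.
Unset Printing Implicit Defensive.

Import Order.TTheory GRing.Theory Num.Theory.
Import numFieldNormedType.Exports.

Local Open Scope classical_set_scope.
Local Open Scope ring_scope.

(** The discrete energy approximates the Dirichlet energy at a rate that is the
    same for all admissible maps, and each discrete energy attains its minimum;
    these two facts give the convergence of the minima to the infimum.

    Uniform rate.  Fix a triangle of the mesh and a point [w] in it.  Let [G] be
    the tangential gradient of [f] at [w], [Q] the orthogonal projector onto the
    tangent plane and [P] the one onto the plane of the lifted triangle.  The
    discrete gradient is obtained by applying the interpolation operator, which
    is [P] ([sum_bary_vec_proj]), to the values of [f] at the vertices.  Replacing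
    these values by the affine map with gradient [G] costs Taylor remainders,
    bounded by [psi''] because [G] is Lipschitz with constant [CL].  What remains
    is [G *m P], and since [G *m Q = G], its distance to [G] is at most
    [frob G * frob (Q *m (1 - P))].  As [P] and [Q] have equal rank, this last norm
    is that of [(1 - Q) *m P] ([frob_proj_swap]), which is a sum of Taylor
    remainders of the parametrization and is bounded by [psi']
    ([tangent_deviation]).  So the discrete and the continuous gradients differ by
    at most [frob G * psi' + psi''] ([discrete_gradient_close]).

    Uniform bounds.  The values of admissible maps lie in the bounded set [N].  A
    map with bounded values and a Lipschitz gradient has a bounded gradient
    ([admissible_tgrad_bounded]), so the estimate above is uniform in [f].  The
    triangles of a mesh overlap in null sets, the integrands are measurable, and
    integrating shows that the two energies differ by a small multiple of the
    area of the surface ([energies_close]).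

    Minimizers.  By these bounds the class of admissible maps is compact for
    pointwise convergence on the surface ([admissible_compact]).  The Taylor
    bound, the Lipschitz bound and the condition on the image all pass to limits
    along ultrafilters, and the Taylor bound recovers differentiability of the
    limit.  A discrete energy depends continuously on finitely many values of the
    map, so it attains its minimum ([discrete_minimizer]). *)

(** * The Frobenius norm *)

Section Frobenius.
Variable R : realType.

(** Lagrange: the gap is half the sum of the [(a i * b j - a j * b i) ^+ 2]. *)
Lemma sum_mul_sqr_le (T : finType) (a b : T -> R) :
  (\sum_i a i * b i) ^+ 2 <= (\sum_i a i ^+ 2) * (\sum_i b i ^+ 2).
Proof.
have : 0 <= \sum_i \sum_j (a i * b j - a j * b i) ^+ 2.
  by apply: sumr_ge0 => i _; apply: sumr_ge0 => j _; exact: sqr_ge0.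
have -> : \sum_i \sum_j (a i * b j - a j * b i) ^+ 2 =
    (\sum_i a i ^+ 2) * (\sum_i b i ^+ 2) + (\sum_i b i ^+ 2) * (\sum_i a i ^+ 2)
    - 2 * ((\sum_i a i * b i) * (\sum_i a i * b i)).
  rewrite !mulr_suml mulr_sumr -sumrN -!big_split /=; apply: eq_bigr => i _.
  rewrite !mulr_sumr -sumrN -!big_split /=; apply: eq_bigr => j _; ring.
by rewrite expr2; nra.
Qed.

Variables (m n : nat).
Implicit Types A B : 'M[R]_(m, n).

Lemma frob_ge0 A : 0 <= frob A.
Proof. exact: sqrtr_ge0. Qed.

Lemma sqr_frob A : frob A ^+ 2 = \sum_i \sum_j A i j ^+ 2.
Proof.
rewrite sqr_sqrtr //; apply: sumr_ge0 => i _; apply: sumr_ge0 => j _.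
exact: sqr_ge0.
Qed.

Lemma sqr_frob_tr A : frob A ^+ 2 = \tr (A^T *m A).
Proof.
rewrite sqr_frob exchange_big /=; apply: eq_bigr => j _; rewrite mxE.
by apply: eq_bigr => i _; rewrite mxE expr2.
Qed.

Lemma le_frob_sqr A (c : R) : 0 <= c -> frob A ^+ 2 <= c ^+ 2 -> frob A <= c.
Proof. by move=> c0; rewrite ler_pXn2r // nnegrE // frob_ge0. Qed.

Lemma frobZ (k : R) A : frob (k *: A) = `|k| * frob A.
Proof.
rewrite /frob -(sqrtr_sqr k) -sqrtrM ?sqr_ge0 //; congr Num.sqrt.
rewrite mulr_sumr; apply: eq_bigr => i _; rewrite mulr_sumr.
by apply: eq_bigr => j _; rewrite mxE exprMn.
Qed.

Lemma frobN A : frob (- A) = frob A.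
Proof. by rewrite -scaleN1r frobZ normrN1 mul1r. Qed.

Lemma frobBC A B : frob (A - B) = frob (B - A).
Proof. by rewrite -frobN opprB. Qed.

Lemma frob0 : frob (0 : 'M[R]_(m, n)) = 0.
Proof. by rewrite -(scale0r 0) frobZ normr0 mul0r. Qed.

Lemma sqr_entry_le_frob A i j : A i j ^+ 2 <= frob A ^+ 2.
Proof.
rewrite sqr_frob (bigD1 i) //= (bigD1 j) //= -addrA lerDl.
apply: addr_ge0; apply: sumr_ge0 => k _; first exact: sqr_ge0.
by apply: sumr_ge0 => l _; exact: sqr_ge0.
Qed.

Lemma entry_le_frob A i j : `|A i j| <= frob A.
Proof.
rewrite -(@ler_pXn2r _ 2) ?nnegrE ?frob_ge0 ?normr_ge0 //.
by rewrite real_normK ?num_real // sqr_entry_le_frob.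
Qed.

Lemma frob_eq0 A : frob A = 0 -> A = 0.
Proof.
move=> A0; apply/matrixP => i j; rewrite mxE; apply/eqP.
by rewrite -normr_le0 -A0 entry_le_frob.
Qed.

Lemma frobD A B : frob (A + B) <= frob A + frob B.
Proof.
apply: le_frob_sqr; first by rewrite addr_ge0 ?frob_ge0.
set s := \sum_(p : 'I_m * 'I_n) A p.1 p.2 * B p.1 p.2.
have -> : frob (A + B) ^+ 2 = frob A ^+ 2 + frob B ^+ 2 + 2 * s.
  rewrite !sqr_frob !pair_bigA mulr_sumr -!big_split /=.
  by apply: eq_bigr => p _; rewrite mxE; ring.
have cs : s ^+ 2 <= (frob A * frob B) ^+ 2.
  by rewrite exprMn !sqr_frob !pair_bigA /=; exact: sum_mul_sqr_le.
have sAB : s <= frob A * frob B.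
  apply: le_trans (ler_norm s) _.
  by rewrite -(@ler_pXn2r _ 2) ?nnegrE ?mulr_ge0 ?frob_ge0 // real_normK ?num_real.
by rewrite sqrrD; nra.
Qed.

Lemma frobB A B : frob (A - B) <= frob A + frob B.
Proof. by rewrite -(frobN B) frobD. Qed.

Lemma frob_triangle A B C : frob (A - C) <= frob (A - B) + frob (B - C).
Proof. by rewrite -[A - C](subrKA B) frobD. Qed.

Lemma frob_le_add A B : frob A <= frob B + frob (A - B).
Proof. by rewrite -{1}[A](subrKC B) frobD. Qed.

Lemma frob_sum (T : finType) (F : T -> 'M[R]_(m, n)) :
  frob (\sum_i F i) <= \sum_i frob (F i).
Proof.
elim/big_ind2 : _ => // [|A a B b ? ?]; first by rewrite frob0.
by apply: le_trans (frobD _ _) (lerD _ _).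
Qed.

Lemma frob_le_sum_entries A : frob A <= \sum_i \sum_j `|A i j|.
Proof.
have s0 (i : 'I_m) : 0 <= \sum_j `|A i j| by apply: sumr_ge0.
have H (T : finType) (a : T -> R) : (forall i, 0 <= a i) ->
    \sum_i a i ^+ 2 <= (\sum_i a i) ^+ 2.
  move=> a0; rewrite [leRHS]expr2 mulr_suml; apply: ler_sum => i _.
  by rewrite expr2 ler_wpM2l // (bigD1 i) //= lerDl sumr_ge0.
apply: le_frob_sqr; first by apply: sumr_ge0.
rewrite sqr_frob; apply: le_trans (H _ _ s0); apply: ler_sum => i _.
apply: le_trans (H _ _ _) => //; apply: ler_sum => j _.
by rewrite real_normK ?num_real.
Qed.

Lemma frob_tr A : frob A^T = frob A.
Proof.
rewrite /frob exchange_big; congr Num.sqrt; apply: eq_bigr => i _.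
by apply: eq_bigr => j _; rewrite mxE.
Qed.

End Frobenius.

Lemma frobM (R : realType) (m n p : nat) (A : 'M[R]_(m, n)) (B : 'M[R]_(n, p)) :
  frob (A *m B) <= frob A * frob B.
Proof.
apply: le_frob_sqr; first by rewrite mulr_ge0 ?frob_ge0.
rewrite exprMn !sqr_frob [X in _ <= _ * X]exchange_big mulr_suml.
apply: ler_sum => i _; rewrite mulr_sumr; apply: ler_sum => j _.
by rewrite mxE; exact: sum_mul_sqr_le.
Qed.

Lemma normr_dotp_le (R : realType) (d : nat) (u v : 'cV[R]_d) :
  `|dotp u v| <= frob u * frob v.
Proof.
rewrite -(frob_tr u); apply: le_trans (frobM _ _); exact: entry_le_frob.
Qed.

Lemma dotp_self (R : realType) (d : nat) (u : 'cV[R]_d) : dotp u u = frob u ^+ 2.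
Proof. by rewrite sqr_frob_tr /dotp /mxtrace big_ord1. Qed.

(** * Orthogonal projectors *)

Section Projectors.
Variable R : realType.

Lemma gram_unit (m k : nat) (X : 'M[R]_(m, k)) :
  \rank X = k -> X^T *m X \in unitmx.
Proof.
move=> rX; rewrite -row_free_unit -kermx_eq0; apply/rowV0P => u /sub_kermxP uK.
have : frob (X *m u^T) ^+ 2 = 0.
  by rewrite sqr_frob_tr trmx_mul trmxK mulmxA -(mulmxA u) uK mul0mx mxtrace0.
move/eqP; rewrite sqrf_eq0 => /eqP/frob_eq0 /(congr1 trmx).
rewrite trmx_mul trmxK trmx0 => uX; apply/eqP.
have fX : row_free X^T by rewrite /row_free mxrank_tr rX.
by rewrite -(mulmx_free_eq0 u fX) uX.
Qed.

(** The Moore-Penrose inverse, when the columns of [X] are independent. *)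
Definition pinv_col (m k : nat) (X : 'M[R]_(m, k)) : 'M[R]_(k, m) :=
  invmx (X^T *m X) *m X^T.

Definition col_proj (m k : nat) (X : 'M[R]_(m, k)) : 'M[R]_m := X *m pinv_col X.

Definition orthoproj (m : nat) (P : 'M[R]_m) : Prop := P^T = P /\ P *m P = P.

Section ColProj.
Variables (m k : nat) (X : 'M[R]_(m, k)).
Hypothesis X_unit : X^T *m X \in unitmx.

Lemma pinv_colK : pinv_col X *m X = 1%:M.
Proof. by rewrite /pinv_col -mulmxA mulVmx. Qed.

Lemma col_projK : col_proj X *m X = X.
Proof. by rewrite /col_proj -mulmxA pinv_colK mulmx1. Qed.

Lemma col_projP : orthoproj (col_proj X).
Proof.
split; last by rewrite {2}/col_proj mulmxA col_projK.
by rewrite /col_proj /pinv_col !trmx_mul trmxK trmx_inv trmx_mul trmxK mulmxA.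
Qed.

Lemma tr_col_proj : \tr (col_proj X) = k%:R.
Proof. by rewrite /col_proj mxtrace_mulC pinv_colK mxtrace1. Qed.

End ColProj.

Lemma orthoprojC (m : nat) (P : 'M[R]_m) : orthoproj P -> orthoproj (1%:M - P).
Proof.
move=> [Ps Pi]; split; first by rewrite linearB /= trmx1 Ps.
by rewrite mulmxBl mul1mx mulmxBr mulmx1 Pi subrr subr0.
Qed.

Lemma sqr_frob_orthoproj (m n : nat) (P : 'M[R]_m) (A : 'M[R]_(m, n)) :
  orthoproj P -> frob (P *m A) ^+ 2 = \tr (A^T *m P *m A).
Proof.
by move=> [Ps Pi]; rewrite sqr_frob_tr trmx_mul Ps mulmxA -(mulmxA A^T P P) Pi.
Qed.

Lemma frob_orthoproj (m n : nat) (P : 'M[R]_m) (A : 'M[R]_(m, n)) :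
  orthoproj P -> frob (P *m A) <= frob A.
Proof.
move=> hP; apply: le_frob_sqr (frob_ge0 _) _.
have := sqr_ge0 (frob ((1%:M - P) *m A)).
rewrite (sqr_frob_orthoproj _ (orthoprojC hP)) sqr_frob_orthoproj // sqr_frob_tr.
by rewrite mulmxBr mulmxBl mulmx1 linearB /= subr_ge0.
Qed.

(** Both squared norms equal the common trace minus the trace of [P *m Q].  This
    turns a bound on how far a lifted triangle leaves the tangent plane into a
    bound on what the projection onto the triangle loses of a tangent vector. *)
Lemma frob_proj_swap (m : nat) (P Q : 'M[R]_m) :
  orthoproj P -> orthoproj Q -> \tr P = \tr Q ->
  frob (Q *m (1%:M - P)) = frob ((1%:M - Q) *m P).
Proof.
move=> hP hQ trPQ; have hP' := orthoprojC hP; have hQ' := orthoprojC hQ.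
have tr_swap (A B : 'M[R]_m) : orthoproj A -> orthoproj B ->
    frob (A *m B) ^+ 2 = \tr (A *m B).
  move=> hA [Bs Bi]; rewrite (sqr_frob_orthoproj _ hA) Bs.
  by rewrite mxtrace_mulC mulmxA Bi mxtrace_mulC.
apply/eqP; rewrite -(@eqrXn2 _ 2) ?frob_ge0 // !tr_swap //; apply/eqP.
by rewrite mulmxBr mulmxBl mulmx1 mul1mx !linearB /= trPQ.
Qed.

End Projectors.

(** * Triangles and barycentric coordinates *)

Section Dotp.
Variables (R : realType) (d : nat).
Implicit Types u v w : 'cV[R]_d.

Lemma dotpC u v : dotp u v = dotp v u.
Proof. by rewrite /dotp -[v]trmxK -trmx_mul mxE trmxK. Qed.

Lemma dotpDr u v w : dotp u (v + w) = dotp u v + dotp u w.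
Proof. by rewrite /dotp mulmxDr mxE. Qed.

Lemma dotpNr u v : dotp u (- v) = - dotp u v.
Proof. by rewrite /dotp mulmxN mxE. Qed.

Lemma dotpBr u v w : dotp u (v - w) = dotp u v - dotp u w.
Proof. by rewrite dotpDr dotpNr. Qed.

Lemma dotpZr (k : R) u v : dotp u (k *: v) = k * dotp u v.
Proof. by rewrite /dotp -scalemxAr mxE. Qed.

Lemma dotp0r u : dotp u 0 = 0.
Proof. by rewrite /dotp mulmx0 mxE. Qed.

Lemma dotpDl u v w : dotp (v + w) u = dotp v u + dotp w u.
Proof. by rewrite dotpC dotpDr !(dotpC u). Qed.

Lemma dotpNl u v : dotp (- v) u = - dotp v u.
Proof. by rewrite dotpC dotpNr dotpC. Qed.

Lemma dotpZl (k : R) u v : dotp (k *: v) u = k * dotp v u.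
Proof. by rewrite dotpC dotpZr dotpC. Qed.

Lemma dotp_sumr (T : finType) u (F : T -> 'cV[R]_d) :
  dotp u (\sum_i F i) = \sum_i dotp u (F i).
Proof. by apply: (big_morph (dotp u)) => [v w|]; rewrite ?dotpDr ?dotp0r. Qed.

Lemma mulmx_trE (k : nat) (u : 'cV[R]_k) v w : u *m v^T *m w = dotp v w *: u.
Proof.
rewrite -mulmxA (_ : v^T *m w = (dotp v w)%:M) ?mul_mx_scalar //.
by apply/matrixP => i j; rewrite !ord1 /dotp [RHS]mxE eqxx mulr1n.
Qed.

End Dotp.

(** The residues are presented as iterated successors, the form in which they
    index consecutive sides. *)
Lemma I3_ind (P : 'I_3 -> Prop) : P 0 -> P 1 -> P (1 + 1) -> forall a, P a.
Proof.
move=> P0 P1 P2 [[|[|[|//]]] Ha].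
- by rewrite (_ : Ordinal Ha = 0) //; exact/val_inj.
- by rewrite (_ : Ordinal Ha = 1) //; exact/val_inj.
- by rewrite (_ : Ordinal Ha = 1 + 1) //; exact/val_inj.
Qed.

Lemma I3_3 : 1 + 1 + 1 = 0 :> 'I_3.
Proof. exact/val_inj. Qed.

Section Triangle.
Variables (R : realType) (d : nat) (p : triangle_of R d).

Lemma side_cyc : side p (1 + 1) = - (side p 0 + side p 1).
Proof. by rewrite /side I3_3 add0r addrA subrK opprB. Qed.

Lemma sum_side : \sum_a side p (a + 1) = 0.
Proof.
have shift (F : 'I_3 -> 'cV[R]_d) : \sum_a F (a + 1) = \sum_a F a.
  by rewrite [RHS](reindex_inj (addIr 1)).
by rewrite shift /side sumrB shift subrr.
Qed.

Lemma sum_bary_vec : \sum_a bary_vec p a = 0.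
Proof. by rewrite /bary_vec /crossb -scaler_sumr -mulmx_sumr sum_side mulmx0 scaler0. Qed.

Lemma diam_ge0 : 0 <= diam p.
Proof. by rewrite /diam; apply/bigmax_geP; left. Qed.

Lemma frob_side_le_diam a : frob (side p a) <= diam p.
Proof. exact: (le_bigmax _ (fun a => frob (side p a))). Qed.

Lemma frob_vertexB_le_diam a b : frob (p a - p b) <= diam p.
Proof.
have I3 : b = a \/ b = a + 1 \/ a = b + 1.
  move: a b; apply: I3_ind; apply: I3_ind; rewrite ?add0r ?I3_3; tauto.
case: I3 => [->|[->|->]]; first by rewrite subrr frob0 diam_ge0.
  exact: frob_side_le_diam.
by rewrite frobBC; exact: frob_side_le_diam.
Qed.

Lemma hull_vertex a : hull p (p a).
Proof.
exists (fun b => (b == a)%:R); split => [b||]; first by rewrite ler0n.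
  by rewrite (bigD1 a) //= eqxx big1 ?addr0 // => b /negPf ->.
rewrite (bigD1 a) //= eqxx scale1r big1 ?addr0 // => b /negPf ->.
by rewrite scale0r.
Qed.

Lemma hull_segment w w' (s : R) : 0 <= s <= 1 -> hull p w -> hull p w' ->
  hull p (w + s *: (w' - w)).
Proof.
move=> /andP[s0 s1] [t [t0 t1 ->]] [t' [t'0 t'1 ->]].
exists (fun a => t a + s * (t' a - t a)); split => [a||].
- have := t0 a; have := t'0 a; nra.
- by rewrite big_split /= -mulr_sumr sumrB t1 t'1 subrr mulr0 addr0.
- rewrite -sumrB scaler_sumr -big_split; apply: eq_bigr => a _ /=.
  by rewrite scalerDl -scalerA scalerBl.
Qed.

Lemma frob_hull_le (w u : 'cV[R]_d) (r : R) :
  (forall a, frob (p a - u) <= r) -> hull p w -> frob (w - u) <= r.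
Proof.
move=> ur [t [t0 t1 ->]].
have -> : \sum_a t a *: p a - u = \sum_a t a *: (p a - u).
  rewrite -[in LHS](scale1r u) -t1 scaler_suml -sumrB.
  by apply: eq_bigr => a _; rewrite scalerBr.
apply: le_trans (frob_sum _) _; rewrite -[r]mul1r -t1 mulr_suml.
by apply: ler_sum => a _; rewrite frobZ ger0_norm // ler_wpM2l.
Qed.

Lemma frob_hullB_le_diam w w' : hull p w -> hull p w' -> frob (w - w') <= diam p.
Proof.
move=> hw hw'; apply: frob_hull_le (hw) => a; rewrite frobBC.
by apply: frob_hull_le (hw') => b; exact: frob_vertexB_le_diam.
Qed.

Hypothesis p_nondeg : nondeg_tri p.

Lemma sqr_area : (2 * area p) ^+ 2 =
  dotp (side p 0) (side p 0) * dotp (side p 1) (side p 1)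
  - dotp (side p 0) (side p 1) ^+ 2.
Proof.
have := p_nondeg; rewrite /nondeg_tri /area pmulr_lgt0 ?invr_gt0 // sqrtr_gt0.
by move=> G; rewrite mulrC divfK ?pnatr_eq0 // sqr_sqrtr // ltW.
Qed.

Lemma area_neq0 : 2 * area p != 0.
Proof. by rewrite mulf_neq0 ?pnatr_eq0 ?gt_eqF. Qed.

Lemma bary_vecE a : bary_vec p a = ((2 * area p) ^+ 2)^-1 *:
  (dotp (side p 1) (side p (a + 1)) *: side p 0
   - dotp (side p 0) (side p (a + 1)) *: side p 1).
Proof.
rewrite /bary_vec /crossb /unit_normal -scalemxAl scalerA -invfM -expr2.
by rewrite /extprod mulmxBl !mulmx_trE.
Qed.

Lemma frob_bary_vec a : frob (bary_vec p a) = frob (side p (a + 1)) / (2 * area p).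
Proof.
have A0 := area_neq0; have A2 := sqr_area.
have Age0 : 0 <= 2 * area p by rewrite mulr_ge0 // ltW.
apply/eqP; rewrite -(@eqrXn2 _ 2) ?divr_ge0 ?frob_ge0 //; apply/eqP.
rewrite expr_div_n -!dotp_self bary_vecE dotpZl dotpZr.
set A := 2 * area p in A0 A2 *.
suff -> : dotp (dotp (side p 1) (side p (a + 1)) *: side p 0
   - dotp (side p 0) (side p (a + 1)) *: side p 1) 
   (dotp (side p 1) (side p (a + 1)) *: side p 0
   - dotp (side p 0) (side p (a + 1)) *: side p 1)
   = A ^+ 2 * dotp (side p (a + 1)) (side p (a + 1)).
  by field.
rewrite A2; have := side_cyc; move: a; apply: I3_ind; rewrite ?add0r ?I3_3;
  move: (side p 0) (side p 1) (side p (1 + 1)) => s t u; [move=> _|move=> ->|move=> _];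
  by rewrite ?(dotpDr, dotpDl, dotpNr, dotpNl, dotpZl, dotpZr) ?(dotpC t s); ring.
Qed.

Lemma frob_bary_vec_le a : frob (bary_vec p a) <= diam p / (2 * area p).
Proof.
by rewrite frob_bary_vec ler_wpM2r ?invr_ge0 ?mulr_ge0 ?frob_side_le_diam // ltW.
Qed.

Lemma dotp_bary_vecB a b c :
  dotp (bary_vec p a) (p b - p c) = (a == b)%:R - (a == c)%:R.
Proof. rewrite -(dotp_bary_vec a b p_nondeg) -(dotp_bary_vec a c p_nondeg) -dotpBr.
by rewrite opprB addrA subrK. Qed.

Definition sides : 'M[R]_(d, 1 + 1) := row_mx (side p 0) (side p 1).

(** Barycentric vectors form a dual basis of the sides; reading a left inverse
    of the sides off them avoids any Gram determinant. *)
Definition dual_sides : 'M[R]_(1 + 1, d) :=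
  col_mx (bary_vec p 0)^T (bary_vec p 0 + bary_vec p 1)^T.

Lemma dual_sidesK : dual_sides *m sides = 1%:M.
Proof.
rewrite /dual_sides /sides mul_col_row -[RHS]submxK.
have E (u v : 'cV[R]_d) : u^T *m v = (dotp u v)%:M.
  by apply/matrixP => i j; rewrite !ord1 /dotp [RHS]mxE eqxx mulr1n.
rewrite !E !dotpDl /side add0r !dotp_bary_vecB /=.
by congr block_mx; apply/matrixP => i j; rewrite !ord1 !mxE /= ; ring.
Qed.

Lemma sides_unit : sides^T *m sides \in unitmx.
Proof.
apply: gram_unit; apply/eqP; rewrite eqn_leq rank_leq_col /=.
by have := mxrankM_maxr dual_sides sides; rewrite dual_sidesK mxrank1.
Qed.

(** The interpolation operator fixes the two sides and its rows lie in the plane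
    of the triangle, which characterizes the orthogonal projector. *)
Lemma sum_bary_vec_proj : \sum_a p a *m (bary_vec p a)^T = col_proj sides.
Proof.
set B := \sum_a _.
have BS : B *m sides = sides.
  have Bside b c : B *m (p b - p c) = p b - p c.
    rewrite /B mulmx_suml.
    under eq_bigr do rewrite mulmx_trE dotp_bary_vecB scalerBl.
    rewrite sumrB (bigD1 b) //= eqxx scale1r big1 ?addr0; last first.
      by move=> a /negPf ->; rewrite scale0r.
    rewrite (bigD1 c) //= eqxx scale1r [X in _ - (_ + X)]big1 ?addr0 // => a /negPf ->.
    by rewrite scale0r.
  by rewrite /sides mul_mx_row !Bside.
have [Ss Si] := col_projP sides_unit.
have := col_projK sides_unit; rewrite [X in _ *m X]/sides mul_mx_row.
move=> /eq_row_mx[P0 P1].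
have BP : B *m col_proj sides = B.
  rewrite /B mulmx_suml; apply: eq_bigr => a _.
  rewrite -{1}Ss -mulmxA -trmx_mul bary_vecE -scalemxAr mulmxBr -!scalemxAr.
  by rewrite P0 P1.
by rewrite -BP {1}/col_proj mulmxA BS.
Qed.

End Triangle.

Section PlaneTriangle.
Variables (R : realType) (p : triangle_of R 2).
Hypothesis p_nondeg : nondeg_tri p.

Definition bary (a : 'I_3) (w : 'cV[R]_2) : R :=
  dotp (bary_vec p a) (w - p 0) + (a == 0)%:R.

Lemma col_proj_sides2 : col_proj (sides p) = 1%:M.
Proof.
by rewrite /col_proj; apply: (@mulmx1C _ 2); exact/pinv_colK/sides_unit.
Qed.

Lemma sum_bary w : \sum_a bary a w = 1.
Proof.
rewrite big_split /= [X in _ + X](bigD1 0) //= [X in _ + (_ + X)]big1 ?addr0; last first.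
  by move=> a /negPf ->.
under eq_bigr do rewrite dotpC.
by rewrite -dotp_sumr sum_bary_vec dotp0r add0r.
Qed.

Lemma bary_comb w : w = \sum_a bary a w *: p a.
Proof.
rewrite /bary; under eq_bigr do rewrite scalerDl -mulmx_trE.
rewrite big_split /= -mulmx_suml sum_bary_vec_proj // col_proj_sides2 mul1mx.
rewrite (bigD1 0) //= scale1r big1 ?addr0 ?subrK // => a /negPf ->.
by rewrite scale0r.
Qed.

Lemma bary_unique (t : 'I_3 -> R) a :
  \sum_b t b = 1 -> bary a (\sum_b t b *: p b) = t a.
Proof.
move=> t1; rewrite /bary.
have -> : \sum_b t b *: p b - p 0 = \sum_b t b *: (p b - p 0).
  rewrite -[in LHS](scale1r (p 0)) -t1 scaler_suml -sumrB.
  by apply: eq_bigr => b _; rewrite scalerBr.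
rewrite dotp_sumr; under eq_bigr do rewrite dotpZr dotp_bary_vecB // mulrBr.
rewrite sumrB -mulr_suml t1 mul1r subrK (bigD1 a) //= eqxx mulr1 big1 ?addr0 //.
by move=> b; rewrite eq_sym => /negPf ->; rewrite mulr0.
Qed.

Lemma hullP w : hull p w <-> forall a, 0 <= bary a w.
Proof.
split => [[t [t0 t1 ->]] a|w0]; first by rewrite bary_unique.
by exists (bary^~ w); split => //; [exact: sum_bary|exact: bary_comb].
Qed.

Lemma bary_lip a w w' :
  `|bary a w' - bary a w| <= frob (bary_vec p a) * frob (w' - w).
Proof.
rewrite /bary opprD addrACA subrr addr0 -dotpBr opprB addrA subrK.
exact: normr_dotp_le.
Qed.

Lemma bary_vec_neq0 a : bary_vec p a != 0.
Proof.
apply/eqP => b0; have := dotp_bary_vec a a p_nondeg.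
rewrite b0 eqxx /dotp trmx0 mul0mx mxE; apply/eqP.
by rewrite eq_sym oner_eq0.
Qed.

End PlaneTriangle.

(** * One-sided Jacobians *)

Lemma nbhs_frobP (R : realType) (d : nat) (w : 'cV[R]_d) (A : set 'cV[R]_d) :
  nbhs w A <-> exists2 e : R, 0 < e & forall w', frob (w' - w) < e -> A w'.
Proof.
split => [/nbhs_ballP[e /= e0 wA]|[e e0 wA]].
  exists e => // w' w'e; apply: wA; split => // i j; rewrite /ball /=.
  apply: le_lt_trans w'e; rewrite frobBC.
  by have := entry_le_frob (w - w') i j; rewrite !mxE.
apply/nbhs_ballP; exists (e / d.+1%:R) => /=; first by rewrite divr_gt0.
move=> w' [_ ww']; apply: wA; rewrite frobBC.
apply: le_lt_trans (frob_le_sum_entries _) _.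
apply: (@le_lt_trans _ _ (\sum_(i < d) (e / d.+1%:R))).
  apply: ler_sum => i _; rewrite big_ord1 !mxE.
  by have := ww' i 0; rewrite /ball /= => /ltW.
rewrite sumr_const card_ord -[_ *+ d]mulr_natl mulrCA gtr_pMr //.
by rewrite ltr_pdivrMr // mul1r ltr_nat.
Qed.

Section Jacobian.
Variables (R : realType) (Om : set 'cV[R]_2).

Lemma is_jacobianP (d : nat) (g : 'cV[R]_2 -> 'cV[R]_d) w J :
  is_jacobian Om g w J <-> forall e : R, 0 < e -> exists2 r : R, 0 < r &
    forall w', Om w' -> frob (w' - w) < r ->
      frob (g w' - g w - J *m (w' - w)) <= e * frob (w' - w).
Proof.
split => gJ e e0; first have /nbhs_frobP[r r0 wr] := gJ _ e0.
  by exists r => // w' Omw' w'r; exact: wr.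
have [r r0 wr] := gJ _ e0.
by apply/nbhs_frobP; exists r => // w' w'r Omw'; exact: wr.
Qed.

Lemma is_jacobianB (d : nat) (g h : 'cV[R]_2 -> 'cV[R]_d) w J L :
  is_jacobian Om g w J -> is_jacobian Om h w L ->
  is_jacobian Om (fun w => g w - h w) w (J - L).
Proof.
move=> /is_jacobianP gJ /is_jacobianP hL; apply/is_jacobianP => e e0.
have e20 : 0 < e / 2 by rewrite divr_gt0.
have [r r0 gr] := gJ _ e20; have [s s0 hs] := hL _ e20.
exists (Num.min r s); first by rewrite lt_min r0.
move=> w' Omw'; rewrite lt_min => /andP[w'r w's].
have -> : g w' - h w' - (g w - h w) - (J - L) *m (w' - w) =
    (g w' - g w - J *m (w' - w)) - (h w' - h w - L *m (w' - w)).
  by rewrite mulmxBl; apply/matrixP => i j; rewrite !mxE; ring.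
have := gr _ Omw' w'r; have := hs _ Omw' w's.
by have := frobB (g w' - g w - J *m (w' - w)) (h w' - h w - L *m (w' - w)); lra.
Qed.

Lemma is_jacobian_mull (c d : nat) (A : 'M[R]_(c, d)) (g : 'cV[R]_2 -> 'cV[R]_d) w J :
  is_jacobian Om g w J -> is_jacobian Om (fun w => A *m g w) w (A *m J).
Proof.
move=> /is_jacobianP gJ; apply/is_jacobianP => e e0.
have A0 : 0 < frob A + 1 by rewrite ltr_wpDl ?frob_ge0.
have [r r0 gr] := gJ _ (divr_gt0 e0 A0); exists r => // w' Omw' w'r.
rewrite -mulmxA -!mulmxBr; apply: le_trans (frobM _ _) _.
apply: le_trans (ler_wpM2l (frob_ge0 _) (gr _ Omw' w'r)) _.
rewrite mulrA ler_wpM2r ?frob_ge0 //.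
by rewrite mulrCA ger_pMr // ler_pdivrMr // mul1r lerDl.
Qed.

Lemma is_jacobian_id w : is_jacobian Om id w 1%:M.
Proof.
apply/is_jacobianP => e e0; exists 1 => // w' _ _.
by rewrite mul1mx subrr frob0 mulr_ge0 ?frob_ge0 ?ltW.
Qed.

Lemma is_jacobian_quad (d : nat) (g : 'cV[R]_2 -> 'cV[R]_d) w J (C r : R) : 0 < r ->
  (forall w', Om w' -> frob (w' - w) < r ->
    frob (g w' - g w - J *m (w' - w)) <= C * frob (w' - w) ^+ 2) ->
  is_jacobian Om g w J.
Proof.
move=> r0 gC; apply/is_jacobianP => e e0.
have C0 : 0 < `|C| + 1 by rewrite ltr_wpDl.
exists (Num.min r (e / (`|C| + 1))); first by rewrite lt_min r0 divr_gt0.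
move=> w' Omw'; rewrite lt_min => /andP[w'r]; rewrite ltr_pdivlMr // => w'e.
apply: le_trans (gC _ Omw' w'r) _; rewrite expr2 mulrA.
have := frob_ge0 (w' - w); have := ler_norm C; nra.
Qed.

Definition in_segment (w w' v : 'cV[R]_2) : Prop :=
  exists2 s : R, 0 <= s <= 1 & v = w + s *: (w' - w).

Lemma frob_in_segment w w' v : in_segment w w' v -> frob (v - w) <= frob (w' - w).
Proof.
move=> [s /andP[s0 s1] ->]; rewrite addrAC subrr add0r frobZ ger0_norm //.
by rewrite ler_piMl ?frob_ge0.
Qed.

Lemma in_segment_ends w w' : in_segment w w' w /\ in_segment w w' w'.
Proof.
split; first by exists 0; rewrite ?lexx ?ler01 // scale0r addr0.
by exists 1; rewrite ?lexx ?ler01 // scale1r addrC subrK.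
Qed.

(** A vector-valued map has no mean value equality, but the component of [g] in
    the direction of its own increment has one along the segment. *)
Lemma mean_value_ineq (d : nat) (g : 'cV[R]_2 -> 'cV[R]_d)
    (J : 'cV[R]_2 -> 'M[R]_(d, 2)) w w' (B : R) :
  (forall v, in_segment w w' v ->
    [/\ Om v, is_jacobian Om g v (J v) & frob (J v *m (w' - w)) <= B]) ->
  frob (g w' - g w) <= B.
Proof.
move=> gJ; set u := w' - w; set r := g w' - g w.
pose pt (s : R) := w + s *: u.
pose f (s : R) := dotp r (g (pt s)); pose df (s : R) := dotp r (J (pt s) *m u).
have seg (s : R) : 0 <= s <= 1 -> in_segment w w' (pt s) by exists s.
have ptB (s s' : R) : pt s' - pt s = (s' - s) *: u.
  by rewrite /pt opprD addrACA subrr add0r scalerBl.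
have loc (s e : R) : 0 <= s <= 1 -> 0 < e -> exists2 a : R, 0 < a &
    forall s' : R, 0 <= s' <= 1 -> `|s' - s| < a ->
      `|f s' - f s - df s * (s' - s)| <= e * `|s' - s|.
  move=> s01 e0; have [_ /is_jacobianP gJs _] := gJ _ (seg _ s01).
  have C0 : 0 < frob r * frob u + 1 by rewrite ltr_wpDl ?mulr_ge0 ?frob_ge0.
  have u0 : 0 < frob u + 1 by rewrite ltr_wpDl ?frob_ge0.
  have [a a0 ga] := gJs _ (divr_gt0 e0 C0).
  exists (a / (frob u + 1)); first by rewrite divr_gt0.
  move=> s' s'01; rewrite ltr_pdivlMr // => s's.
  have [Oms' _ _] := gJ _ (seg _ s'01).
  have sa : `|s' - s| * frob u < a.
    by apply: le_lt_trans s's; rewrite ler_wpM2l // lerDl.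
  have := ga _ Oms'; rewrite ptB frobZ => /(_ sa) gas.
  have -> : f s' - f s - df s * (s' - s) =
      dotp r (g (pt s') - g (pt s) - J (pt s) *m ((s' - s) *: u)).
    by rewrite !dotpBr -scalemxAr dotpZr (mulrC (s' - s)).
  apply: le_trans (normr_dotp_le _ _) _.
  apply: le_trans (ler_wpM2l (frob_ge0 _) gas) _.
  rewrite [leLHS](_ : _ = e * `|s' - s| * (frob r * frob u / (frob r * frob u + 1)));
    last by ring.
  by rewrite ler_piMr ?mulr_ge0 ?(ltW e0) // ler_pdivrMr // mul1r lerDl.
have fd (s : R) : s \in `]0, 1[%R -> is_derive s 1 f (df s).
  rewrite in_itv /= => /andP[s0 s1].
  have H : h^-1 *: (f (h *: 1 + s) - f s) @[h --> 0^'] --> df s.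
    apply/cvgrPdist_le => /= e e0.
    have [|a a0 fa] := loc s _ _ e0; first by rewrite !ltW.
    apply/nbhs_ballP; exists (Num.min a (Num.min s (1 - s))) => /=.
      by rewrite !lt_min a0 s0 subr_gt0 s1.
    move=> h; rewrite /ball /= sub0r normrN !lt_min => /and3P[ha hs hs1] h0.
    have h01 : 0 <= h *: 1 + s <= 1.
      move: hs hs1; rewrite [h *: 1]mulr1 !ltr_norml => /andP[? ?] /andP[? ?].
      by apply/andP; split; lra.
    have := fa _ h01; rewrite [h *: 1]mulr1 addrK => /(_ ha) fh.
    rewrite -[_ *: _]/(_ * _) distrC.
    have -> : h^-1 * (f (h + s) - f s) - df s = h^-1 * (f (h + s) - f s - df s * h).
      by field.
    by rewrite normrM normfV ler_pdivrMl ?normr_gt0 // (mulrC _ e).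
  by constructor; [apply/cvg_ex; exists (df s)|exact: cvg_lim].
have fc : {within `[0, 1], continuous f}.
  apply/subspace_continuousP => s; rewrite /= in_itv /= => s01.
  apply/cvgrPdist_le => /= e e0.
  have [a a0 fa] := loc s 1 s01 ltr01.
  have D0 : 0 < `|df s| + 1 by rewrite ltr_wpDl.
  apply/nbhs_ballP; exists (Num.min a (e / (`|df s| + 1))) => /=.
    by rewrite lt_min a0 divr_gt0.
  move=> s'; rewrite /ball /= lt_min ltr_pdivlMr // => /andP[s'a s'e].
  rewrite in_itv /= => s'01; rewrite distrC in s'a; rewrite distrC in s'e.
  have := fa _ s'01 s'a; rewrite mul1r => fs.
  have := ler_normD (f s' - f s - df s * (s' - s)) (df s * (s' - s)).
  by rewrite subrK normrM (distrC (f s)); nra.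
have [c c01] := MVT ltr01 fd fc; rewrite subr0 mulr1 => fE.
have [_ _ JB] : [/\ Om (pt c), is_jacobian Om g (pt c) (J (pt c)) &
    frob (J (pt c) *m (w' - w)) <= B].
  apply: gJ; exists c => //; move: c01; rewrite in_itv /= => /andP[? ?].
  by rewrite !ltW.
have rr : frob r ^+ 2 = df c.
  by rewrite -fE /f -dotpBr /pt scale1r scale0r addr0 /u (addrC w) subrK dotp_self.
have := le_trans (ler_norm _) (normr_dotp_le r (J (pt c) *m u)).
rewrite -/(df c) -rr -/u in JB * => rJ.
have [->|r0] := eqVneq (frob r) 0; first by apply: le_trans JB; exact: frob_ge0.
rewrite -(@ler_pM2l _ (frob r)) ?lt0r ?r0 ?frob_ge0 // -expr2.
by apply: le_trans rJ _; rewrite ler_wpM2l ?frob_ge0.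
Qed.

End Jacobian.

(** * Differential calculus on a meshed surface *)

Section Meshed.
Variables (R : realType) (Om : set 'cV[R]_2) (K : mesh Om).

Lemma hull_sub t : hull (tri K t) `<=` Om.
Proof. by move=> w tw; have <- := tri_cover K; exists t. Qed.

Lemma mesh_cover w : Om w -> exists t, hull (tri K t) w.
Proof.
move=> Omw; have : (\bigcup_t hull (tri K t)) w by rewrite tri_cover.
by case=> t _ tw; exists t.
Qed.

Lemma bounded_on_mesh (F : 'cV[R]_2 -> R) :
  (forall t, exists B, forall w, hull (tri K t) w -> F w <= B) ->
  exists2 B, 0 <= B & forall w, Om w -> F w <= B.
Proof.
move=> /choice[B FB]; exists (\sum_t `|B t|); first by apply: sumr_ge0.
move=> w /mesh_cover[t /FB FBt]; apply: le_trans FBt (le_trans (ler_norm _) _).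
by rewrite (bigD1 t) //= lerDl sumr_ge0.
Qed.

Lemma domain_bounded : exists2 D, 0 <= D & forall w, Om w -> frob w <= D.
Proof.
apply: bounded_on_mesh => t; exists (frob (tri K t 0) + diam (tri K t)) => w tw.
apply: le_trans (frob_le_add _ (tri K t 0)) (lerD (lexx _) _).
exact: frob_hullB_le_diam (hull_vertex _ _).
Qed.

(** The closed triangles that avoid [w] are finitely many, hence at a positive
    distance from it.  So segments issued from [w] to close points of the domain
    stay in the domain, although the domain need not be convex. *)
Lemma common_triangle (w : 'cV[R]_2) : exists2 r : R, 0 < r & forall w', Om w' ->
  frob (w' - w) < r -> exists t, hull (tri K t) w /\ hull (tri K t) w'.
Proof.
have H t : exists r : R, 0 < r /\ forall w', hull (tri K t) w' ->
    frob (w' - w) < r -> hull (tri K t) w.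
  have nd := tri_nondeg t.
  have [tw|ntw] := pselect (hull (tri K t) w); first by exists 1; split.
  have [a /negP] : exists a, ~ 0 <= bary (tri K t) a w.
    by apply/existsNP => ?; apply: ntw; apply/(hullP nd).
  rewrite -ltNge => wa; have b0 : 0 < frob (bary_vec (tri K t) a).
    rewrite lt0r frob_ge0 andbT; apply: contra (bary_vec_neq0 nd a).
    by move=> /eqP/frob_eq0 ->.
  exists (- bary (tri K t) a w / frob (bary_vec (tri K t) a)).
  rewrite divr_gt0 ?oppr_gt0 //; split => // w' /(hullP nd)/(_ a) w'a.
  rewrite ltr_pdivlMr // mulrC => w'w; exfalso.
  have := le_lt_trans (bary_lip (tri K t) a w w') w'w.
  by rewrite ltr_norml; lra.
have [r rP] := choice H.
exists (\big[Num.min/1]_t r t).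
  by elim/big_ind : _ => // [a b|t _]; [rewrite lt_min => -> ->|case: (rP t)].
move=> w' Omw' w'w; have [t tw'] := mesh_cover Omw'; exists t; split => //.
have [_ /(_ w' tw')] := rP t; apply; apply: lt_le_trans w'w _.
exact: bigmin_le.
Qed.

(** The triangle around [w] contains segments issued from [w] in two independent
    directions, even when [w] is a boundary point of the domain. *)
Lemma jacobian_unique (d : nat) (g : 'cV[R]_2 -> 'cV[R]_d) w J L :
  Om w -> is_jacobian Om g w J -> is_jacobian Om g w L -> J = L.
Proof.
move=> Omw gJ gL; have [t tw] := mesh_cover Omw; set p := tri K t in tw *.
have nd : nondeg_tri p := tri_nondeg t.
have /is_jacobianP D0 := is_jacobianB gJ gL; set D := J - L in D0.
have Du a : D *m (p a - w) = 0.
  apply: frob_eq0; apply/eqP; rewrite eq_le frob_ge0 andbT.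
  apply/ler_addgt0Pr => e e0; rewrite add0r.
  set u := p a - w; have u0 : 0 < frob u + 1 by rewrite ltr_wpDl ?frob_ge0.
  have [r r0 Dr] := D0 _ (divr_gt0 e0 u0).
  pose s := Num.min 1 (r / (frob u + 1) / 2).
  have s0 : 0 < s by rewrite lt_min ltr01 !divr_gt0.
  have s1 : s <= 1 by rewrite ge_min lexx.
  have sr : s * (frob u + 1) < r.
    rewrite -ltr_pdivlMr // gt_min; apply/orP; right.
    by rewrite ltr_pdivrMr // ltr_pMr ?divr_gt0 // ltr1n.
  have wsw : w + s *: u - w = s *: u by rewrite addrAC subrr add0r.
  have Omws : Om (w + s *: u).
    by apply: (@hull_sub t); apply: hull_segment; rewrite ?s1 ?ltW //; exact: hull_vertex.
  have := Dr _ Omws; rewrite wsw !subrr sub0r -scalemxAr frobN !frobZ gtr0_norm //.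
  rewrite mulrDr mulr1 in sr; move=> /(_ _)/le_trans H.
  rewrite -(@ler_pM2l _ s) //; apply: H; first by apply: le_lt_trans sr; rewrite lerDl ltW.
  rewrite mulrCA ler_pM2l // mulrAC ler_pdivrMr // ler_wpM2l ?ltW //.
  by rewrite ltrDl.
have Dab a b : D *m (p a - p b) = 0.
  have -> : p a - p b = (p a - w) - (p b - w) by rewrite opprB addrA subrK.
  by rewrite mulmxBr !Du subrr.
have : D *m sides p = 0 by rewrite /sides mul_mx_row !Dab row_mx0.
move=> /(congr1 (mulmx^~ (pinv_col (sides p)))); rewrite mul0mx -mulmxA.
rewrite -/(col_proj _) col_proj_sides2 // mulmx1 => /eqP.
by rewrite subr_eq0 => /eqP.
Qed.

Lemma jacobian_inE (d : nat) (g : 'cV[R]_2 -> 'cV[R]_d) w J :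
  Om w -> is_jacobian Om g w J -> jacobian_in Om g w = J.
Proof.
move=> Omw gJ; apply: (jacobian_unique (g := g) Omw _ gJ).
by rewrite /jacobian_in; case: xgetP => [y ->|/(_ J)].
Qed.

Lemma jacobian_inP (d : nat) (g : 'cV[R]_2 -> 'cV[R]_d) w :
  differentiable_in Om g -> Om w -> is_jacobian Om g w (jacobian_in Om g w).
Proof. by move=> gd Omw; have [J gJ] := gd _ Omw; rewrite (jacobian_inE Omw gJ). Qed.

End Meshed.

Section LipTgrad.
Variables (R : realType) (Om : set 'cV[R]_2) (m n : nat).
Variables (x : 'cV[R]_2 -> 'cV[R]_m) (f : 'cV[R]_m -> 'cV[R]_n) (c : R).

Lemma lip_tgradP : 0 <= c ->
  (lip_tgrad Om x f <= c%:E)%E <-> forall w w', Om w -> Om w' ->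
    frob (tgrad Om x f w - tgrad Om x f w') <= c * frob (x w - x w').
Proof.
move=> c0; split => [fc w w' Omw Omw'|fc].
  apply/ler_addgt0Pr => e e0; set d := frob (x w - x w').
  have d0 : 0 < d + 1 by rewrite ltr_wpDl ?frob_ge0.
  have : (lip_tgrad Om x f < (c + e / (d + 1))%:E)%E.
    by apply: le_lt_trans fc _; rewrite lte_fin ltrDl divr_gt0.
  move=> /ereal_inf_lt[_ [c' [_ fc'] <-]]; rewrite lte_fin => c'c.
  apply: le_trans (fc' _ _ Omw Omw') _; rewrite -/d.
  apply: le_trans (ler_wpM2r (frob_ge0 _) (ltW c'c)) _; rewrite -/d mulrDl lerD2l.
  by rewrite mulrAC ler_pdivrMr // ler_wpM2l ?lerDl // ltW.
by apply: ereal_inf_lbound; exists c.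
Qed.

End LipTgrad.

Section Surface.
Variables (R : realType) (m : nat) (Om : set 'cV[R]_2) (x : 'cV[R]_2 -> 'cV[R]_m).
Variables (CM : R) (K : mesh Om).
Hypothesis hx : simple_surface Om x CM.

Local Notation X := (jacobian_in Om x).
Local Notation sig := (sigma_max Om x).

Lemma surface_jacobian w : Om w -> is_jacobian Om x w (X w).
Proof. by case: hx => _ xd _ _; exact: jacobian_inP. Qed.

Lemma surface_gram_unit w : Om w -> (X w)^T *m X w \in unitmx.
Proof. by case: hx => _ _ rX _ Omw; apply: gram_unit; exact: rX. Qed.

Lemma surface_lip w w' : Om w -> Om w' ->
  frob (X w - X w') <= CM * frob (w - w').
Proof. by case: hx => _ _ _; exact. Qed.

Lemma lip_const_ge0 (t : 'I_(ntri K)) : 0 <= CM.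
Proof.
have Omt a := hull_sub (hull_vertex (tri K t) a).
have := le_trans (frob_ge0 _) (surface_lip (Omt 0) (Omt 1)).
rewrite pmulr_lge0 // lt0r frob_ge0 andbT; apply/negP => /eqP/frob_eq0 p01.
have := dotp_bary_vec 0 0 (tri_nondeg t).
rewrite add0r p01 dotp0r eqxx; apply/eqP.
by rewrite eq_sym oner_eq0.
Qed.

Lemma frob_jacobian_le w : Om w -> frob (X w) <= sig.
Proof.
move=> Omw; apply: ub_le_sup; last by exists w.
have [D D0 OmD] := domain_bounded K.
exists (frob (X w) + `|CM| * (D + D)) => _ [v Omv <-].
apply: le_trans (frob_le_add _ (X w)) _; rewrite lerD2l.
apply: le_trans (surface_lip Omv Omw) _.
apply: le_trans (ler_wpM2r (frob_ge0 _) (ler_norm CM)) _.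
rewrite ler_wpM2l //; apply: le_trans (frobB _ _) _.
by rewrite lerD ?OmD.
Qed.

Definition segment_in (w w' : 'cV[R]_2) : Prop := forall v, in_segment w w' v -> Om v.

Lemma hull_segment_in t w w' :
  hull (tri K t) w -> hull (tri K t) w' -> segment_in w w'.
Proof. by move=> tw tw' _ [s s01 ->]; apply: (@hull_sub _ _ K t); exact: hull_segment. Qed.

Lemma surface_lip_segment w w' : segment_in w w' ->
  frob (x w' - x w) <= sig * frob (w' - w).
Proof.
move=> ww'; apply: (mean_value_ineq (Om := Om) (J := X)) => v /ww' Omv; split => //.
  exact: surface_jacobian.
by apply: le_trans (frobM _ _) _; rewrite ler_wpM2r ?frob_ge0 ?frob_jacobian_le.
Qed.

Lemma surface_taylor w w' : 0 <= CM -> segment_in w w' ->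
  frob (x w' - x w - X w *m (w' - w)) <= CM * frob (w' - w) ^+ 2.
Proof.
move=> CM0 ww'; have [/ww' Omw /ww' Omw'] := in_segment_ends w w'.
rewrite (_ : _ - _ = (x w' - X w *m w') - (x w - X w *m w)); last first.
  by rewrite mulmxBr; apply/matrixP => i j; rewrite !mxE; ring.
apply: (mean_value_ineq (Om := Om) (g := fun w' => x w' - X w *m w')
  (J := fun v => X v - X w *m 1%:M)) => v vww'.
have Omv := ww' _ vww'; split => //.
  apply: is_jacobianB; first exact: surface_jacobian.
  exact: (is_jacobian_mull _ (is_jacobian_id _ _)).
apply: le_trans (frobM _ _) _; rewrite mulmx1 expr2 mulrA.
rewrite ler_wpM2r ?frob_ge0 //; apply: le_trans (surface_lip Omv Omw) _.
by rewrite ler_wpM2l ?frob_in_segment.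
Qed.

Section Map.
Variables (n : nat) (f : 'cV[R]_m -> 'cV[R]_n) (CL : R).
Hypothesis CL_ge0 : 0 <= CL.
Hypothesis fx_diff : differentiable_in Om (f \o x).
Hypothesis tgrad_lip : forall w w', Om w -> Om w' ->
  frob (tgrad Om x f w - tgrad Om x f w') <= CL * frob (x w - x w').

Local Notation G := (tgrad Om x f).

Lemma tgrad_jacobian w : Om w -> G w *m X w = jacobian_in Om (f \o x) w.
Proof.
move=> Omw; rewrite /tgrad -!mulmxA -/(pinv_col _) mulVmx ?mulmx1 //.
exact: surface_gram_unit.
Qed.

Lemma tgrad_proj w : Om w -> G w *m col_proj (X w) = G w.
Proof.
move=> Omw; rewrite /col_proj mulmxA tgrad_jacobian //.
by rewrite /tgrad /pinv_col mulmxA.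
Qed.

(** Along a segment the derivative of [f \o x - G w *m x] is
    [(G v - G w) *m X v], of norm at most [CL * sig * |v - w| * sig]. *)
Lemma map_taylor w w' : segment_in w w' ->
  frob (f (x w') - f (x w) - G w *m (x w' - x w)) <=
  CL * sig ^+ 2 * frob (w' - w) ^+ 2.
Proof.
move=> ww'; have [/ww' Omw /ww' Omw'] := in_segment_ends w w'.
have sig0 : 0 <= sig := le_trans (frob_ge0 _) (frob_jacobian_le Omw).
rewrite (_ : _ - _ = (f (x w') - G w *m x w') - (f (x w) - G w *m x w)); last first.
  by rewrite mulmxBr; apply/matrixP => i j; rewrite !mxE; ring.
apply: (mean_value_ineq (Om := Om) (g := fun w' => f (x w') - G w *m x w')
  (J := fun v => jacobian_in Om (f \o x) v - G w *m X v)) => v vww'.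
have Omv := ww' _ vww'; split => //.
  apply: is_jacobianB; first exact: (jacobian_inP K).
  by apply: is_jacobian_mull; exact: surface_jacobian.
apply: le_trans (frobM _ _) _; rewrite -tgrad_jacobian // -mulmxBl.
rewrite (expr2 (frob _)) mulrA ler_wpM2r ?frob_ge0 //.
apply: le_trans (frobM _ _) _.
have H : frob (G v - G w) <= CL * (sig * frob (w' - w)).
  apply: le_trans (tgrad_lip Omv Omw) _; rewrite ler_wpM2l //.
  apply: (@le_trans _ _ (sig * frob (v - w))).
    apply: surface_lip_segment => u [s /andP[s0 s1] ->]; apply: ww'.
    case: vww' => r /andP[r0 r1] ->; exists (s * r).
      by rewrite mulr_ge0 ?mulr_ile1.
    by rewrite [w + _ - w]addrAC subrr add0r scalerA.
  by rewrite ler_wpM2l ?frob_in_segment.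
apply: le_trans (ler_wpM2r (frob_ge0 _) H) _.
apply: le_trans (ler_wpM2l _ (frob_jacobian_le Omv)) _.
  by rewrite !mulr_ge0 ?frob_ge0.
by rewrite le_eqVlt; apply/orP; left; apply/eqP; ring.
Qed.

End Map.

(** Taylor bounds survive pointwise limits, unlike differentiability; this is how
    the gradient of a limit of admissible maps is recognized. *)
Lemma tgrad_of_taylor (n : nat) (g : 'cV[R]_2 -> 'cV[R]_n) w (G : 'M[R]_(n, m)) (C : R) :
  Om w -> G *m col_proj (X w) = G ->
  (forall t w', hull (tri K t) w -> hull (tri K t) w' ->
    frob (g w' - g w - G *m (x w' - x w)) <= C * frob (w' - w) ^+ 2) ->
  is_jacobian Om g w (G *m X w).
Proof.
move=> Omw GX gC; have [r r0 near_w] := common_triangle K w.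
apply: (is_jacobian_quad (C := C + frob G * CM) r0) => w' Omw' w'w.
have [t [tw tw']] := near_w _ Omw' w'w.
have -> : g w' - g w - G *m X w *m (w' - w) = (g w' - g w - G *m (x w' - x w))
    + G *m (x w' - x w - X w *m (w' - w)).
  by rewrite (mulmxBr G (x w' - x w)) mulmxA addrA subrK.
apply: le_trans (frobD _ _) _; rewrite mulrDl lerD ?(gC t) //.
apply: le_trans (frobM _ _) _; rewrite -mulrA ler_wpM2l ?frob_ge0 //.
by apply: surface_taylor; [exact: lip_const_ge0 t|exact: (hull_segment_in tw)].
Qed.

End Surface.

(** * Uniform bounds on the admissible maps *)

Lemma frob_row_mx_le (R : realType) (d : nat) (u v : 'cV[R]_d) :
  frob (row_mx u v) <= frob u + frob v.
Proof.
have -> : row_mx u v = row_mx u 0 + row_mx 0 v by rewrite add_row_mx addr0 add0r.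
apply: le_trans (frobD _ _) _; apply: lerD; apply: le_frob_sqr; rewrite ?frob_ge0 //;
  rewrite !sqr_frob; apply: ler_sum => i _.
  rewrite (@big_split_ord _ _ _ 1 1) /= [X in _ + X]big1 ?addr0 => [|j _].
    by apply: ler_sum => j _; rewrite row_mxEl.
  by rewrite row_mxEr mxE expr0n.
rewrite (@big_split_ord _ _ _ 1 1) /= [X in X + _]big1 ?add0r => [|j _].
  by apply: ler_sum => j _; rewrite row_mxEr.
by rewrite row_mxEl mxE expr0n.
Qed.

Section Bounds.
Variables (R : realType) (m n : nat) (Om : set 'cV[R]_2) (x : 'cV[R]_2 -> 'cV[R]_m).
Variables (CM : R) (K : mesh Om) (N : set 'cV[R]_n) (CL : R).
Hypothesis hx : simple_surface Om x CM.
Hypothesis CL_ge0 : 0 <= CL.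

Local Notation X := (jacobian_in Om x).
Local Notation sig := (sigma_max Om x).
Local Notation adm := (admissible Om x N CL).
Local Notation G f := (tgrad Om x f).

Lemma admissible_lip f w w' : adm f -> Om w -> Om w' ->
  frob (G f w - G f w') <= CL * frob (x w - x w').
Proof. by move=> [_ _ /(lip_tgradP _ _ _ CL_ge0)]; exact. Qed.

Lemma admissible_taylor f w w' : adm f -> segment_in Om w w' ->
  frob (f (x w') - f (x w) - G f w *m (x w' - x w)) <=
  CL * sig ^+ 2 * frob (w' - w) ^+ 2.
Proof.
move=> fadm; have [fd _ _] := fadm; apply: (map_taylor K hx CL_ge0 fd) => v v'.
exact: admissible_lip.
Qed.

Lemma admissible_tgrad_proj f w : adm f -> Om w ->
  G f w *m col_proj (X w) = G f w.
Proof. by move=> _; exact: (tgrad_proj hx). Qed.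

Lemma sigma_max_ge0 w : Om w -> 0 <= sig.
Proof. by move=> /(frob_jacobian_le K hx); apply: le_trans; exact: frob_ge0. Qed.

Lemma surface_bounded : exists2 B, 0 <= B & forall w, Om w -> frob (x w) <= B.
Proof.
apply: (bounded_on_mesh (K := K)) => t; set p := tri K t.
exists (frob (x (p 0)) + sig * diam p) => w tw.
apply: le_trans (frob_le_add _ (x (p 0))) _; rewrite lerD2l.
have p0 := hull_vertex p 0.
apply: le_trans (surface_lip_segment K hx (hull_segment_in p0 tw)) _.
by rewrite ler_wpM2l ?(sigma_max_ge0 (hull_sub p0)) ?frob_hullB_le_diam.
Qed.

(** The constant depends on [f] only through its gradient at [w], so that a
    uniform bound on the gradients yields equicontinuity on each triangle. *)
Lemma admissible_increment f t w w' : adm f ->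
  hull (tri K t) w -> hull (tri K t) w' ->
  frob (f (x w') - f (x w)) <=
  (frob (G f w) * sig + CL * sig ^+ 2 * diam (tri K t)) * frob (w' - w).
Proof.
move=> fadm tw tw'; have ww' := hull_segment_in tw tw'.
have sig0 := sigma_max_ge0 (hull_sub tw).
apply: le_trans (frob_le_add _ (G f w *m (x w' - x w))) _.
rewrite mulrDl lerD //.
  apply: le_trans (frobM _ _) _; rewrite -mulrA ler_wpM2l ?frob_ge0 //.
  exact: (surface_lip_segment K hx).
apply: le_trans (admissible_taylor fadm ww') _.
rewrite (expr2 (frob _)) mulrA ler_wpM2r ?frob_ge0 // ler_wpM2l ?frob_hullB_le_diam //.
by rewrite mulr_ge0 ?exprn_ge0.
Qed.

Lemma admissible_values_bounded : adm !=set0 ->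
  exists2 B, 0 <= B & forall f w, adm f -> Om w -> frob (f (x w)) <= B.
Proof.
move=> [f0 f0adm]; have [_ f0N _] := f0adm.
have [B B0 f0B] : exists2 B, 0 <= B & forall w, Om w -> frob (f0 (x w)) <= B.
  apply: (bounded_on_mesh (K := K)) => t; set p := tri K t.
  exists (frob (f0 (x (p 0))) +
    (frob (G f0 (p 0)) * sig + CL * sig ^+ 2 * diam p) * diam p) => w tw.
  have p0 := hull_vertex p 0; have sig0 := sigma_max_ge0 (hull_sub p0).
  apply: le_trans (frob_le_add _ (f0 (x (p 0)))) _; rewrite lerD2l.
  apply: le_trans (admissible_increment f0adm p0 tw) _.
  rewrite ler_wpM2l ?frob_hullB_le_diam // addr_ge0 ?mulr_ge0 ?frob_ge0 ?exprn_ge0 //.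
  exact: diam_ge0.
exists B => // f w [_ fN _] Omw.
have : N (f (x w)) by rewrite -fN; exists (x w) => //; exists w.
by rewrite -f0N => -[_ [v Omv <-] <-]; exact: f0B.
Qed.

(** The values are bounded, so at a vertex a difference quotient of step [s]
    controls [G *m X *m u] up to a multiple of [s * frob G], which is absorbed for
    a small [s]; the Lipschitz condition propagates the bound to the whole
    surface. *)
Lemma admissible_tgrad_bounded : adm !=set0 ->
  exists2 B, 0 <= B & forall f w, adm f -> Om w -> frob (G f w) <= B.
Proof.
move=> /admissible_values_bounded[B B0 fB].
have [[v0 Omv0]|Om0] := pselect (exists w, Om w); last first.
  by exists 0 => // f w _ Omw; case: Om0; exists w.
have [t _] := mesh_cover K Omv0; set p := tri K t.
have nd : nondeg_tri p := tri_nondeg t.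
have CM0 := lip_const_ge0 hx t.
set w0 := p 0; have tw0 : hull p w0 := hull_vertex p 0.
have Omw0 : Om w0 := hull_sub tw0; have sig0 := sigma_max_ge0 Omw0.
set d := diam p; have d0 : 0 <= d := diam_ge0 p.
pose C := CL * sig ^+ 2 * d ^+ 2.
have C0 : 0 <= C by rewrite !mulr_ge0 ?exprn_ge0.
set M := pinv_col (sides p) *m pinv_col (X w0); set D := frob M.
have D0 : 0 <= D := frob_ge0 _.
pose E := 3 * D * CM * d ^+ 2.
have E0 : 0 <= E by rewrite !mulr_ge0 ?exprn_ge0.
(* The absorbed term is [E * s * frob G], at most half of [frob G]. *)
pose s := (2 * (E + 1))^-1.
have s0 : 0 < s by rewrite invr_gt0 mulr_gt0 // ltr_wpDl.
have s1 : s <= 1 by rewrite invf_le1 ?mulr_gt0 ?ltr_wpDl //; lra.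
have Es : E * s <= 2^-1 by rewrite /s ler_pdivrMr ?mulr_gt0 ?ltr_wpDl //; lra.
have [Bx Bx0 xB] := surface_bounded.
exists (6 * D * (2 * B + C) / s + CL * (Bx + Bx)).
  by rewrite addr_ge0 ?divr_ge0 ?mulr_ge0 ?addr_ge0 // ?mulr_ge0 // ltW.
move=> f w fadm Omw.
suff Gw0 : frob (G f w0) <= 6 * D * (2 * B + C) / s.
  apply: le_trans (frob_le_add _ (G f w0)) _; apply: lerD Gw0 _.
  apply: le_trans (admissible_lip fadm Omw Omw0) _; rewrite ler_wpM2l //.
  by apply: le_trans (frobB _ _) _; rewrite lerD ?xB.
set g := frob (G f w0).
have dir a : frob (G f w0 *m X w0 *m (p a - w0)) <= (2 * B + C) / s + g * CM * s * d ^+ 2.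
  set u := p a - w0; have ud : frob u <= d by exact: frob_vertexB_le_diam.
  have tv : hull p (w0 + s *: u).
    by apply: hull_segment => //; rewrite ?s1 ?ltW //; exact: hull_vertex.
  set v := w0 + s *: u in tv; have Omv : Om v := hull_sub tv.
  have vw0 : v - w0 = s *: u by rewrite /v addrAC subrr add0r.
  have vd : frob (v - w0) ^+ 2 <= s ^+ 2 * d ^+ 2.
    rewrite -exprMn ler_pXn2r ?nnegrE ?frob_ge0 ?mulr_ge0 ?(ltW s0) //.
    by rewrite vw0 frobZ gtr0_norm // ler_wpM2l // ltW.
  have seg := hull_segment_in tw0 tv.
  have H1 := admissible_taylor fadm seg.
  have H2 := surface_taylor K hx CM0 seg.
  have sE : s * frob (G f w0 *m X w0 *m u) <= (B + B) + C * s ^+ 2 + g * (CM * (s ^+ 2 * d ^+ 2)).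
    rewrite -{1}(gtr0_norm s0) -frobZ scalemxAr -vw0.
    have -> : G f w0 *m X w0 *m (v - w0) = (f (x v) - f (x w0))
        - (f (x v) - f (x w0) - G f w0 *m (x v - x w0))
        - G f w0 *m (x v - x w0 - X w0 *m (v - w0)).
      by rewrite (mulmxBr (G f w0) (x v - x w0)) mulmxA subKr subKr.
    apply: le_trans (frobB _ _) (lerD _ _).
      apply: le_trans (frobB _ _) (lerD _ _).
        by apply: le_trans (frobB _ _) _; rewrite lerD ?fB.
      apply: le_trans H1 _; rewrite /C -(mulrA _ (d ^+ 2)) (mulrC (d ^+ 2)).
      by rewrite ler_wpM2l ?mulr_ge0 ?exprn_ge0.
    apply: le_trans (frobM _ _) _; rewrite ler_wpM2l ?frob_ge0 //.
    by apply: le_trans H2 _; rewrite ler_wpM2l.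
  rewrite -(ler_pM2l s0); apply: le_trans sE _.
  have -> : s * ((2 * B + C) / s + g * CM * s * d ^+ 2) =
     2 * B + C + g * (CM * (s ^+ 2 * d ^+ 2)).
    by field; rewrite gt_eqF.
  have : C * s ^+ 2 <= C by rewrite ler_piMr // exprn_ile1 // ltW.
  by lra.
have GS : frob (G f w0 *m X w0 *m sides p) <= 3 * ((2 * B + C) / s + g * CM * s * d ^+ 2).
  rewrite /sides mul_mx_row; apply: le_trans (frob_row_mx_le _ _) _.
  have := dir 1; have := dir (1 + 1); rewrite /w0 /side add0r => d2 d1.
  have e0 : p 0 - p 1 = - (p 1 - p 0) by rewrite opprB.
  have e1 : p 1 - p (1 + 1) = (p 1 - p 0) - (p (1 + 1) - p 0).
    by rewrite opprB addrA subrK.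
  rewrite [in X in X + _]e0 mulmxN frobN [in X in _ + X]e1 [in X in _ + X]mulmxBr.
  by have := frobB (G f (p 0) *m X (p 0) *m (p 1 - p 0))
    (G f (p 0) *m X (p 0) *m (p (1 + 1) - p 0)); lra.
have gE : g <= 3 * ((2 * B + C) / s + g * CM * s * d ^+ 2) * D.
  apply: le_trans (ler_wpM2r D0 GS); apply: le_trans (frobM _ _).
  have -> : G f w0 *m X w0 *m sides p *m M = G f w0; last by [].
  rewrite /M mulmxA -[_ *m sides p *m _]mulmxA -/(col_proj _).
  by rewrite col_proj_sides2 // mulmx1 -mulmxA admissible_tgrad_proj.
have gE' : g <= 3 * D * (2 * B + C) / s + g * (E * s).
  by apply: le_trans gE _; rewrite /E le_eqVlt; apply/orP; left; apply/eqP; ring.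
have g0 : 0 <= g := frob_ge0 _.
have : g * (E * s) <= g * 2^-1 by rewrite ler_wpM2l.
by move: gE'; set q := _ / s; rewrite (_ : 6 * D * (2 * B + C) / s = 2 * q); [lra|rewrite /q; ring].
Qed.

End Bounds.

(** * Limits along ultrafilters, and existence of minimizers *)

Section UltraLimits.
Variables (R : realType) (T : Type) (U : set_system T).
Context {UU : UltraFilter U}.

Definition ulim (m n : nat) (h : T -> 'M[R]_(m, n)) (l : 'M[R]_(m, n)) : Prop :=
  forall e : R, 0 < e -> \forall f \near U, frob (h f - l) < e.

Lemma ultra_bounded_cvg (h : T -> R) (B : R) :
  (\forall f \near U, `|h f| <= B) ->
  exists l, forall e : R, 0 < e -> \forall f \near U, `|h f - l| < e.
Proof.
move=> hB.
have [|l [_ hl]] := @segment_compact R (- B) B (h @ U).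
  by near=> f; rewrite /= in_itv /= -ler_norml; near: f.
exists l => e e0; have [//|] := in_ultra_setVsetC [set f | `|h f - l| < e] UU.
move=> nU; exfalso.
have [y [/= nye ye]] := hl [set y | ~ `|y - l| < e] (ball l e) nU (nbhsx_ballx l e e0).
by apply: nye; rewrite distrC.
Unshelve. all: by end_near. Qed.

Lemma ulim_bounded (m n : nat) (h : T -> 'M[R]_(m, n)) (B : R) :
  (\forall f \near U, frob (h f) <= B) -> exists l, ulim h l.
Proof.
move=> hB.
have /choice[l lP] (ij : 'I_m * 'I_n) : exists l, forall e : R, 0 < e ->
    \forall f \near U, `|h f ij.1 ij.2 - l| < e.
  apply: (@ultra_bounded_cvg _ B); apply: filterS hB => f.
  by apply: le_trans; exact: entry_le_frob.
exists (\matrix_(i, j) l (i, j)) => e e0.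
pose k : R := (m * n)%:R + 1; have k0 : 0 < k by rewrite ltr_wpDl.
have : \forall f \near U, forall ij : 'I_m * 'I_n, `|h f ij.1 ij.2 - l ij| < e / k.
  by apply: filter_forall => ij; apply: lP; rewrite divr_gt0.
apply: filterS => f hf; apply: le_lt_trans (frob_le_sum_entries _) _.
rewrite pair_bigA /=; apply: (@le_lt_trans _ _ (\sum_(ij : 'I_m * 'I_n) (e / k))).
  by apply: ler_sum => ij _; rewrite !mxE -surjective_pairing; exact: ltW.
rewrite sumr_const card_prod !card_ord -[_ *+ (m * n)]mulr_natl mulrCA gtr_pMr //.
by rewrite ltr_pdivrMr // mul1r ltrDl.
Qed.

Lemma ulim_cst (m n : nat) (A : 'M[R]_(m, n)) : ulim (fun=> A) A.
Proof. by move=> e e0; apply: nearW => f; rewrite subrr frob0. Qed.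

Lemma ulimD (m n : nat) (h k : T -> 'M[R]_(m, n)) A B :
  ulim h A -> ulim k B -> ulim (fun f => h f + k f) (A + B).
Proof.
move=> hA kB e e0; have e20 : 0 < e / 2 by rewrite divr_gt0.
near=> f.
have hAf : frob (h f - A) < e / 2 by near: f; exact: hA.
have kBf : frob (k f - B) < e / 2 by near: f; exact: kB.
rewrite opprD addrACA.
by have := frobD (h f - A) (k f - B); lra.
Unshelve. all: by end_near. Qed.

Lemma ulimB (m n : nat) (h k : T -> 'M[R]_(m, n)) A B :
  ulim h A -> ulim k B -> ulim (fun f => h f - k f) (A - B).
Proof.
move=> hA kB; apply: ulimD => // e e0; apply: filterS (kB _ e0) => f.
by rewrite -opprD frobN.
Qed.

Lemma ulim_sum (I : finType) (m n : nat) (h : I -> T -> 'M[R]_(m, n)) l :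
  (forall i, ulim (h i) (l i)) -> ulim (fun f => \sum_i h i f) (\sum_i l i).
Proof.
move=> hl; elim: (index_enum I) => [|i s IHs].
  rewrite big_nil (_ : (fun _ => _) = fun=> 0); first exact: ulim_cst.
  by apply/funext => f; rewrite big_nil.
rewrite big_cons (_ : (fun _ => _) = fun f => h i f + \sum_(j <- s) h j f).
  exact: ulimD.
by apply/funext => f; rewrite big_cons.
Qed.

Lemma ulim_frob (m n : nat) (h : T -> 'M[R]_(m, n)) A :
  ulim h A -> frob (h f) @[f --> U] --> frob A.
Proof.
move=> hA; apply/cvgrPdist_lt => e e0; apply: filterS (hA _ e0) => f hf.
apply: le_lt_trans hf; rewrite ler_norml; apply/andP; split.
  by have := frob_le_add (h f) A; lra.
by have := frob_le_add A (h f); rewrite frobBC; lra.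
Qed.

Lemma ulim_mulr (m n p : nat) (h : T -> 'M[R]_(m, n)) A (B : 'M[R]_(n, p)) :
  ulim h A -> ulim (fun f => h f *m B) (A *m B).
Proof.
move=> hA e e0; have B0 : 0 < frob B + 1 by rewrite ltr_wpDl ?frob_ge0.
apply: filterS (hA _ (divr_gt0 e0 B0)) => f; rewrite ltr_pdivlMr // => hf.
rewrite -mulmxBl; apply: le_lt_trans (frobM _ _) (le_lt_trans _ hf).
by rewrite ler_wpM2l ?frob_ge0 // lerDl.
Qed.

Lemma ulim_frob_le (m n : nat) (h : T -> 'M[R]_(m, n)) A (c : R) :
  ulim h A -> (\forall f \near U, frob (h f) <= c) -> frob A <= c.
Proof.
move=> hA hc; apply/ler_addgt0Pr => e e0.
have [f [hfc hfA]] := filter_ex (filterI hc (hA _ e0)).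
apply: le_trans (frob_le_add _ (h f)) _; rewrite frobBC.
by apply: lerD => //; exact: ltW.
Qed.

Lemma ulim_unique (m n : nat) (h : T -> 'M[R]_(m, n)) A B :
  ulim h A -> ulim h B -> A = B.
Proof.
move=> hA hB; apply/eqP; rewrite -subr_eq0; apply/eqP/frob_eq0/eqP.
rewrite eq_le frob_ge0 andbT; apply: ulim_frob_le (ulimB hA hB) _.
by apply: nearW => f; rewrite subrr frob0.
Qed.

Lemma eq_ulim (m n : nat) (h k : T -> 'M[R]_(m, n)) A :
  (\forall f \near U, h f = k f) -> ulim h A -> ulim k A.
Proof.
move=> hk hA e e0; apply: filterS (filterI hk (hA _ e0)) => f [-> //].
Qed.

Lemma ultra_finite (k : nat) (A : 'I_k -> set T) :
  (\forall f \near U, exists t, A t f) -> exists t, \forall f \near U, A t f.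
Proof.
move=> UA; apply: contrapT => nA.
have : \forall f \near U, forall t, ~ A t f.
  apply: filter_forall => t; have [At|//] := in_ultra_setVsetC (A t) UU.
  by exfalso; apply: nA; exists t.
by move=> /(filterI UA)/filter_ex[f [[t At] /(_ t)]].
Qed.

(** Among finitely many closed bounded triangles an ultrafilter selects one. *)
Lemma ulim_domain (Om : set 'cV[R]_2) (K : mesh Om) (w : T -> 'cV[R]_2) :
  (\forall f \near U, Om (w f)) ->
  exists t w0, [/\ hull (tri K t) w0, \forall f \near U, hull (tri K t) (w f) & ulim w w0].
Proof.
move=> wOm; have [|t wt] := @ultra_finite _ (fun t f => hull (tri K t) (w f)).
  by apply: filterS wOm => f; exact: mesh_cover.
have [D D0 OmD] := domain_bounded K.
have [|w0 ww0] := @ulim_bounded _ _ w D.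
  by apply: filterS wOm => f; exact: OmD.
exists t, w0; split => //; have nd := tri_nondeg t.
apply/(hullP nd) => a; apply/ler_addgt0Pr => e e0.
set b := frob (bary_vec (tri K t) a).
have b0 : 0 < b + 1 by rewrite ltr_wpDl ?frob_ge0.
have [f [/(hullP nd)/(_ a) wfa]] := filter_ex (filterI wt (ww0 _ (divr_gt0 e0 b0))).
rewrite ltr_pdivlMr // frobBC => wfe.
have := bary_lip (tri K t) a (w f) w0; rewrite -/b ler_norml => /andP[+ _].
have := frob_ge0 (w0 - w f); nra.
Qed.

End UltraLimits.

Lemma is_jacobian_eq (R : realType) (Om : set 'cV[R]_2) (d : nat)
    (g h : 'cV[R]_2 -> 'cV[R]_d) w J :
  (forall v, Om v -> g v = h v) -> Om w -> is_jacobian Om g w J -> is_jacobian Om h w J.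
Proof.
move=> gh Omw /is_jacobianP gJ; apply/is_jacobianP => e /gJ[r r0 rP]; exists r => //.
by move=> w' Omw' w'w; rewrite -!gh //; exact: rP.
Qed.

Section Compactness.
Variables (R : realType) (m n : nat) (Om : set 'cV[R]_2) (x : 'cV[R]_2 -> 'cV[R]_m).
Variables (CM : R) (K : mesh Om) (N : set 'cV[R]_n) (CL : R).
Hypothesis hx : simple_surface Om x CM.
Hypothesis CL_ge0 : 0 <= CL.

Local Notation X := (jacobian_in Om x).
Local Notation sig := (sigma_max Om x).
Local Notation adm := (admissible Om x N CL).
Local Notation G f := (tgrad Om x f).

(** The Taylor bound and the Lipschitz bound are closed conditions on the pair of
    the map and its gradient, so the pointwise limits of both again form such a
    pair; the bound on the gradients makes the maps equicontinuous on each
    triangle, hence the image survives. *)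
Lemma admissible_compact (U : set_system ('cV[R]_m -> 'cV[R]_n)) (UU : UltraFilter U) :
  U adm -> exists2 f0, adm f0 &
    forall w, Om w -> ulim U (fun f => f (x w)) (f0 (x w)).
Proof.
move=> Uadm; have adm0 : adm !=set0 by exact: filter_ex Uadm.
have [B _ valB] := admissible_values_bounded K hx CL_ge0 adm0.
have [BG BG0 gradB] := admissible_tgrad_bounded K hx CL_ge0 adm0.
have /choice[g gP] w : exists l, Om w -> ulim U (fun f => f (x w)) l.
  have [Omw|] := pselect (Om w); last by exists 0.
  have [|l fl] := @ulim_bounded _ _ U _ _ _ (fun f => f (x w)) B; last by exists l.
  by apply: filterS Uadm => f fadm; exact: valB.
have /choice[H HP] w : exists l, Om w -> ulim U (fun f => G f w) l.
  have [Omw|] := pselect (Om w); last by exists 0.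
  have [|l fl] := @ulim_bounded _ _ U _ _ _ (fun f => G f w) BG; last by exists l.
  by apply: filterS Uadm => f fadm; exact: gradB.
(* The limit is known on the surface only, and read there through the injective
   parametrization. *)
pose f0 (y : 'cV[R]_m) := g (xget 0 [set w | Om w /\ x w = y]).
have f0E w : Om w -> f0 (x w) = g w.
  move=> Omw; rewrite /f0; case: xgetP => [v -> [Omv xv]|/(_ w)]; last by case.
  by case: hx => xinj _ _ _; congr g; apply: xinj; rewrite ?inE.
have HX w : Om w -> H w *m col_proj (X w) = H w.
  move=> Omw; apply: (ulim_unique _ (HP _ Omw)).
  apply: eq_ulim (ulim_mulr _ (HP _ Omw)); apply: filterS Uadm => f fadm.
  exact: (admissible_tgrad_proj hx fadm).
have gT t w w' : hull (tri K t) w -> hull (tri K t) w' ->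
    frob (g w' - g w - H w *m (x w' - x w)) <= CL * sig ^+ 2 * frob (w' - w) ^+ 2.
  move=> tw tw'; have Omw := hull_sub tw; have Omw' := hull_sub tw'.
  apply: ulim_frob_le (ulimB (ulimB (gP _ Omw') (gP _ Omw)) (ulim_mulr _ (HP _ Omw))) _.
  apply: filterS Uadm => f fadm.
  exact: (admissible_taylor K hx CL_ge0 fadm (hull_segment_in tw tw')).
have gJ w : Om w -> is_jacobian Om (f0 \o x) w (H w *m X w).
  move=> Omw; apply: (@is_jacobian_eq _ _ _ g) => //=; first by move=> v /f0E ->.
  by apply: (tgrad_of_taylor (K := K) hx Omw (HX _ Omw)) => t w'; exact: gT.
have f0G w : Om w -> G f0 w = H w.
  move=> Omw; rewrite /tgrad (jacobian_inE K Omw (gJ _ Omw)).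
  by rewrite -[RHS]HX // /col_proj /pinv_col !mulmxA.
have f0lim w : Om w -> ulim U (fun f => f (x w)) (f0 (x w)).
  by move=> Omw; rewrite f0E //; exact: gP.
have incr t w (v : ('cV[R]_m -> 'cV[R]_n) -> 'cV[R]_2) :
    hull (tri K t) w -> (\forall f \near U, hull (tri K t) (v f)) -> ulim U v w ->
    ulim U (fun f => f (x (v f))) (f0 (x w)).
  move=> tw tv vw e e0; have Omw := hull_sub tw.
  set C := BG * sig + CL * sig ^+ 2 * diam (tri K t).
  have sig0 := sigma_max_ge0 K hx Omw.
  have C0 : 0 <= C by rewrite addr_ge0 ?mulr_ge0 ?exprn_ge0 ?diam_ge0.
  have e20 : 0 < e / 2 by rewrite divr_gt0.
  have C10 : 0 < C + 1 by rewrite ltr_wpDl.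
  near=> f.
  have fadm : adm f by near: f; exact: Uadm.
  have tvf : hull (tri K t) (v f) by near: f; exact: tv.
  have fw : frob (f (x w) - f0 (x w)) < e / 2 by near: f; exact: f0lim.
  have vf : frob (v f - w) < e / 2 / (C + 1) by near: f; apply: vw; rewrite divr_gt0.
  have fv := admissible_increment hx CL_ge0 fadm tw tvf.
  have : frob (f (x (v f)) - f (x w)) <= C * frob (v f - w).
    apply: le_trans fv _; rewrite ler_wpM2r ?frob_ge0 // lerD2r ler_wpM2r //.
    exact: gradB.
  move: vf; rewrite ltr_pdivlMr // => vf.
  have := frob_triangle (f (x (v f))) (f (x w)) (f0 (x w)).
  by have := frob_ge0 (v f - w); nra.
exists f0 => //; split.
- by move=> w Omw; exists (H w *m X w); exact: gJ.
- have [f1 f1adm] := adm0; have [_ f1N _] := f1adm.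
  (* Each value is pulled back along the ultrafilter to parameters [v f], which
     converge inside one triangle: for the inclusion of the image in [N] by means
     of the fixed map [f1], for the converse by means of [f] itself. *)
  apply/seteqP; split => [_ [_ [w Omw <-] <-]|y Ny].
    have /choice[v vP] f : exists v, adm f -> Om v /\ f1 (x v) = f (x w).
      have [fadm|] := pselect (adm f); last by exists 0.
      have [_ fN _] := fadm; have : N (f (x w)) by rewrite -fN; exists (x w) => //; exists w.
      by rewrite -f1N => -[_ [v Omv <-] fv]; exists v.
    have [|t [w0 [tw0 tv vw0]]] := @ulim_domain _ _ U _ _ K v.
      by apply: filterS Uadm => f /vP[].
    have Omw0 := hull_sub tw0.
    rewrite -f1N; exists (x w0); first by exists w0.
    apply: (ulim_unique (U := U) _ (f0lim _ Omw)).
    have f1v : ulim U (fun f => f1 (x (v f))) (f1 (x w0)).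
      move=> e e0.
      set C := frob (G f1 w0) * sig + CL * sig ^+ 2 * diam (tri K t).
      have sig0 := sigma_max_ge0 K hx Omw0.
      have C0 : 0 < C + 1.
        by rewrite ltr_wpDl // addr_ge0 ?mulr_ge0 ?exprn_ge0 ?diam_ge0 ?frob_ge0.
      apply: filterS (filterI tv (vw0 _ (divr_gt0 e0 C0))) => f [tvf].
      rewrite ltr_pdivlMr // => vf.
      have := admissible_increment hx CL_ge0 f1adm tw0 tvf; rewrite -/C.
      by have := frob_ge0 (v f - w0); nra.
    by apply: (eq_ulim _ f1v); apply: filterS Uadm => f /vP[].
  have /choice[v vP] f : exists v, adm f -> Om v /\ f (x v) = y.
    have [fadm|] := pselect (adm f); last by exists 0.
    have [_ fN _] := fadm; have : (f @` (x @` Om)) y by rewrite fN.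
    by case=> _ [v Omv <-] fv; exists v.
  have [|t [w0 [tw0 tv vw0]]] := @ulim_domain _ _ U _ _ K v.
    by apply: filterS Uadm => f /vP[].
  exists (x w0); first by exists w0 => //; exact: (hull_sub tw0).
  apply: (ulim_unique (U := U) (incr _ _ _ tw0 tv vw0)).
  by apply: (eq_ulim _ (ulim_cst y)); apply: filterS Uadm => f /vP[_ ->].
- apply/(lip_tgradP _ _ _ CL_ge0) => w w' Omw Omw'; rewrite !f0G //.
  apply: ulim_frob_le (ulimB (HP _ Omw) (HP _ Omw')) _.
  by apply: filterS Uadm => f fadm; exact: (admissible_lip CL_ge0 fadm).
Unshelve. all: by end_near. Qed.

(** The sets of admissible maps of energy close to the infimum generate a filter;
    the limit of an ultrafilter finer than it is a minimizer. *)
Lemma admissible_minimizer (e : ('cV[R]_m -> 'cV[R]_n) -> R) : adm !=set0 ->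
  (forall f, 0 <= e f) ->
  (forall (U : set_system ('cV[R]_m -> 'cV[R]_n)) (f0 : 'cV[R]_m -> 'cV[R]_n),
    UltraFilter U -> (forall w, Om w -> ulim U (fun f => f (x w)) (f0 (x w))) ->
    e f @[f --> U] --> e f0) ->
  exists2 f0, adm f0 & forall f, adm f -> e f0 <= e f.
Proof.
move=> adm0 e0 ecvg.
set s := inf (e @` adm).
have hinf : has_inf (e @` adm).
  split; first by have [f fadm] := adm0; exists (e f); exists f.
  by exists 0 => _ [f _ <-].
pose F := filter_from [set r : R | 0 < r] (fun r => [set f | adm f /\ e f < s + r]).
have FF : ProperFilter F.
  apply: filter_from_proper; last first.
    by move=> r /= r0; have [_ [f fadm <-] fr] := inf_adherent r0 hinf; exists f.
  apply: filter_from_filter; first by exists 1 => /=.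
  move=> r1 r2 /= r10 r20; exists (Num.min r1 r2); first by rewrite /= lt_min r10.
  by move=> f /= [fadm]; rewrite -ltrBlDl lt_min !ltrBlDl => /andP[].
have [U [UU FU]] := ultraFilterLemma FF.
have Uadm : U adm.
  by apply: FU; exists 1 => /= [|f []].
have [f0 f0adm f0lim] := admissible_compact UU Uadm.
exists f0 => // f fadm.
have sf : s <= e f by apply: ge_inf; [exact: hinf.2|exists f].
apply: le_trans sf; apply/ler_addgt0Pr => r r0.
have r20 : 0 < r / 2 by rewrite divr_gt0.
have /cvgrPdist_lt/(_ _ r20) ef0 := ecvg _ _ UU f0lim.
have Ur : U [set f | adm f /\ e f < s + r / 2] by apply: FU; exists (r / 2).
have [h [[_ hr] hf0]] := filter_ex (filterI Ur ef0).
have := ler_norm (e f0 - e h); lra.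
Qed.

End Compactness.

(** * Consistency of the discrete gradient on one triangle *)

Section BarySums.
Variables (R : realType) (m n : nat) (p : triangle_of R m).
Hypothesis p_nondeg : nondeg_tri p.

Lemma vertex_values_bary (f : 'cV[R]_m -> 'cV[R]_n) :
  vertex_values f p *m (bary_mx p)^T = \sum_a f (p a) *m (bary_vec p a)^T.
Proof.
apply/matrixP => i j; rewrite mxE summxE; apply: eq_bigr => a _.
by rewrite !mxE big_ord1 !mxE.
Qed.

Lemma sum_bary_vecB (r : 'I_3 -> 'cV[R]_n) (c : 'cV[R]_n) :
  \sum_a (r a - c) *m (bary_vec p a)^T = \sum_a r a *m (bary_vec p a)^T.
Proof.
under eq_bigr do rewrite mulmxBl.
by rewrite sumrB -mulmx_sumr -linear_sum /= sum_bary_vec trmx0 mulmx0 subr0.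
Qed.

Lemma frob_bary_sum_le (r : 'I_3 -> 'cV[R]_n) (c : R) : (forall a, frob (r a) <= c) ->
  frob (\sum_a r a *m (bary_vec p a)^T) <= 3 * c * diam p / (2 * area p).
Proof.
move=> rc; apply: le_trans (frob_sum _) _.
have -> : 3 * c * diam p / (2 * area p) = \sum_(a < 3) (c * (diam p / (2 * area p))).
  by rewrite sumr_const card_ord -mulr_natl; ring.
apply: ler_sum => a _; apply: le_trans (frobM _ _) _; rewrite frob_tr.
by apply: ler_pM; rewrite ?frob_ge0 // frob_bary_vec_le.
Qed.

End BarySums.

Section Consistency.
Variables (R : realType) (m n : nat) (Om : set 'cV[R]_2) (x : 'cV[R]_2 -> 'cV[R]_m).
Variables (CM : R) (K : mesh Om) (N : set 'cV[R]_n) (CL : R).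
Hypothesis hx : simple_surface Om x CM.
Hypothesis CL_ge0 : 0 <= CL.

Local Notation X := (jacobian_in Om x).
Local Notation sig := (sigma_max Om x).

(** The vertices of the lifted triangle leave the tangent plane by second order
    Taylor remainders only, so its plane is nearly tangent. *)
Lemma tangent_deviation t w : hull (tri K t) w -> nondeg_tri (lift_tri x (tri K t)) ->
  frob ((1%:M - col_proj (X w)) *m col_proj (sides (lift_tri x (tri K t))))
  <= psi' Om x CM (tri K t).
Proof.
set p := tri K t; set v := lift_tri x p => tw nd.
have Omw : Om w := hull_sub tw; have CM0 := lip_const_ge0 hx t.
have XU := surface_gram_unit hx Omw; set Q := col_proj (X w).
have QX : (1%:M - Q) *m X w = 0 by rewrite mulmxBl mul1mx col_projK // subrr.
pose r a := x (p a) - x w - X w *m (p a - w).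
have -> : (1%:M - Q) *m col_proj (sides v) =
    \sum_a ((1%:M - Q) *m r a) *m (bary_vec v a)^T.
  rewrite -sum_bary_vec_proj // mulmx_sumr.
  rewrite -[RHS](sum_bary_vecB v _ (- ((1%:M - Q) *m x w))).
  apply: eq_bigr => a _; rewrite mulmxA; congr (_ *m _).
  by rewrite /r (mulmxBr _ (x (p a) - x w)) (mulmxA _ (X w)) QX mul0mx subr0
    mulmxBr opprK subrK.
apply: le_trans (frob_bary_sum_le nd (c := CM * diam p ^+ 2) _) _ => [a|].
  apply: le_trans (frob_orthoproj _ (orthoprojC (col_projP XU))) _.
  have seg := hull_segment_in tw (hull_vertex p a).
  apply: le_trans (surface_taylor K hx CM0 seg) _; rewrite ler_wpM2l //.
  rewrite ler_pXn2r ?nnegrE ?frob_ge0 ?diam_ge0 //.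
  exact: frob_hullB_le_diam (hull_vertex p a) tw.
rewrite /psi' -/v.
have A0 : 0 < area v := nd.
have y0 : 0 <= 3 * CM * diam v * diam p ^+ 2 / area v.
  by rewrite !mulr_ge0 ?invr_ge0 ?exprn_ge0 ?diam_ge0 ?(ltW A0).
have -> : 3 * (CM * diam p ^+ 2) * diam v / (2 * area v) =
    (3 * CM * diam v * diam p ^+ 2 / area v) / 2 by field; rewrite gt_eqF.
by have := sqr_ge0 (3 * CM * diam p ^+ 3 / (sigma_min Om x * area p)); lra.
Qed.

(** With [P] and [Q] the projectors onto the plane of the lifted triangle and
    onto the tangent plane, the discrete gradient is [G *m P] up to Taylor
    remainders, while [G - G *m P = G *m (Q *m (1 - P))], to which
    [frob_proj_swap] applies. *)
Lemma discrete_gradient_close f t w : admissible Om x N CL f ->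
  hull (tri K t) w -> nondeg_tri (lift_tri x (tri K t)) ->
  frob (vertex_values f (lift_tri x (tri K t)) *m (bary_mx (lift_tri x (tri K t)))^T
    - tgrad Om x f w) <=
  frob (tgrad Om x f w) * psi' Om x CM (tri K t) + psi'' Om x CL (tri K t).
Proof.
set p := tri K t; set v := lift_tri x p; move=> fadm tw nd; have Omw : Om w := hull_sub tw.
have XU := surface_gram_unit hx Omw; have VU := sides_unit nd.
set G := tgrad Om x f w; set P := col_proj (sides v); set Q := col_proj (X w).
have GQ : G *m Q = G := admissible_tgrad_proj hx fadm Omw.
pose r a := f (x (p a)) - f (x w) - G *m (x (p a) - x w).
have -> : vertex_values f v *m (bary_mx v)^T - G =
    \sum_a r a *m (bary_vec v a)^T - G *m (Q *m (1%:M - P)).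
  rewrite vertex_values_bary mulmxA GQ mulmxBr mulmx1 opprB addrA.
  congr (_ - G); rewrite /P -sum_bary_vec_proj // mulmx_sumr -big_split /=.
  rewrite -[LHS](sum_bary_vecB v _ (f (x w) - G *m x w)); apply: eq_bigr => a _.
  rewrite mulmxA -mulmxDl; congr (_ *m _); rewrite /r mulmxBr.
  by apply/matrixP => i j; rewrite !mxE; ring.
apply: le_trans (frobB _ _) _; rewrite addrC lerD //.
  apply: le_trans (frobM _ _) _; rewrite ler_wpM2l ?frob_ge0 //.
  rewrite frob_proj_swap ?tr_col_proj //; [|exact: col_projP|exact: col_projP].
  exact: tangent_deviation.
apply: le_trans (frob_bary_sum_le nd (c := CL * sig ^+ 2 * diam p ^+ 2) _) _ => [a|].
  have seg := hull_segment_in tw (hull_vertex p a).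
  apply: le_trans (admissible_taylor K hx CL_ge0 fadm seg) _.
  apply: ler_wpM2l; first by rewrite mulr_ge0 ?sqr_ge0.
  rewrite ler_pXn2r ?nnegrE ?frob_ge0 ?diam_ge0 //.
  exact: frob_hullB_le_diam (hull_vertex p a) tw.
by rewrite /psi'' -/v le_eqVlt; apply/orP; left; apply/eqP; ring.
Qed.

(** The factor in front of [d] depends on a gradient bound only, hence is common
    to all admissible maps once their gradients are uniformly bounded. *)
Lemma discrete_density_close (BG d : R) f t w : admissible Om x N CL f ->
  hull (tri K t) w -> nondeg_tri (lift_tri x (tri K t)) ->
  frob (tgrad Om x f w) <= BG ->
  `|psi' Om x CM (tri K t)| < d -> `|psi'' Om x CL (tri K t)| < d -> d <= 1 ->
  `|frob (vertex_values f (lift_tri x (tri K t)) *m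
      (bary_mx (lift_tri x (tri K t)))^T) ^+ 2 - frob (tgrad Om x f w) ^+ 2|
  <= (BG + 1) * (3 * BG + 1) * d.
Proof.
set v := lift_tri x _; move=> fadm tw nd GB p1d p2d d1; have := discrete_gradient_close fadm tw nd.
rewrite /= -/v; set Z := _ *m _; set G := tgrad _ _ _ _ in GB *.
set p1 := psi' _ _ _ _ in p1d *; set p2 := psi'' _ _ _ _ in p2d * => ZG.
have G0 := frob_ge0 G; have Z0 := frob_ge0 Z.
have d0 : 0 <= d by apply: le_trans (ltW p1d); exact: normr_ge0.
have p1' : p1 <= d by apply: le_trans (ler_norm _) (ltW p1d).
have p2' : p2 <= d by apply: le_trans (ler_norm _) (ltW p2d).
have e1 : frob (Z - G) <= (BG + 1) * d by nra.
have h1 := frob_le_add Z G; have h2 := frob_le_add G Z.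
rewrite (frobBC G) in h2.
have -> : frob Z ^+ 2 - frob G ^+ 2 = (frob Z - frob G) * (frob Z + frob G) by ring.
rewrite normrM (ger0_norm (addr_ge0 Z0 G0)).
rewrite -mulrA (mulrC _ d) mulrA; apply: ler_pM => //; first by rewrite addr_ge0.
  by rewrite ler_norml; apply/andP; split; lra.
by have := frob_ge0 (Z - G); nra.
Qed.

End Consistency.

(** * Measure and integration in the parameter plane *)

Section Plane.
Variable R : realType.

Local Notation plane := (measurableTypeR R * measurableTypeR R)%type.
Local Notation mu := (@lebesgue_measure R \x @lebesgue_measure R)%E.
Local Notation pre D := (@param R @^-1` D : set plane).

Lemma measurable_param (i : 'I_2) :
  measurable_fun [set: plane] (fun z => param z i 0 : measurableTypeR R).
Proof.
have [i0|i0] := eqVneq i 0.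
  rewrite (_ : (fun _ => _) = fst); first exact: measurable_fst.
  by apply/funext => z; rewrite mxE i0.
rewrite (_ : (fun _ => _) = snd); first exact: measurable_snd.
by apply/funext => z; rewrite mxE (negPf i0).
Qed.

Lemma bary_param (p : triangle_of R 2) a (z : R * R) :
  bary p a (param z) = \sum_i bary_vec p a i 0 * param z i 0 + bary p a 0.
Proof.
rewrite /bary sub0r dotpNr addrA dotpBr; congr (_ - _ + _).
by rewrite /dotp mxE; apply: eq_bigr => i _; rewrite !mxE.
Qed.

Lemma measurable_bary (p : triangle_of R 2) a :
  measurable_fun [set: plane] (fun z => bary p a (param z)).
Proof.
rewrite (_ : (fun _ => _) = fun z : plane =>
  \sum_i bary_vec p a i 0 * param z i 0 + bary p a 0); last first.
  by apply/funext => z; exact: bary_param.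
apply: measurable_funD => //; apply: measurable_sum => i.
by apply: measurable_funM => //; exact: measurable_param.
Qed.

Lemma measurable_hull (p : triangle_of R 2) : nondeg_tri p -> measurable (pre (hull p)).
Proof.
move=> nd; have -> : pre (hull p) =
    \bigcap_(a in [set: 'I_3]) [set z : plane | bary p a (param z) \in `[0, +oo[].
  apply/seteqP; split => z /= => [/(hullP nd) h a _|h]; last apply/(hullP nd) => a.
    by rewrite /= in_itv /= h.
  by have := h a I; rewrite /= in_itv /= andbT.
apply: fin_bigcap_measurable => [|a _]; first exact: finite_finset.
have := measurable_bary p a measurableT (measurable_itv `[0, +oo[).
by rewrite setTI.
Qed.

Lemma line_null (p : triangle_of R 2) a : nondeg_tri p ->
  mu.-negligible (pre [set w | bary p a w = 0]).
Proof.
move=> nd; have mA : measurable (pre [set w | bary p a w = 0]).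
  have := measurable_bary p a measurableT (measurable_set1 0).
  by rewrite setTI.
apply/negligibleP => //; rewrite -[LHS]/(mu _); have b0 := bary_vec_neq0 nd a.
have E (z : R * R) : bary p a (param z) =
    bary_vec p a 0 0 * z.1 + bary_vec p a 1 0 * z.2 + bary p a 0.
  by rewrite bary_param !big_ord_recl big_ord0 addr0 !mxE /= (_ : lift _ _ = 1) //;
    exact/val_inj.
move: E; set u := bary_vec p a 0 0; set v := bary_vec p a 1 0; set c := bary p a 0 => E.
have [v0|v0] := eqVneq v 0.
  have u0 : u != 0.
    apply: contra b0 => /eqP u0; apply/eqP/colP => i; rewrite [RHS]mxE.
    have [->//|i0] := eqVneq i 0; rewrite (_ : i = 1) //; apply/val_inj.
    by case: i i0 => [[|[|//]]].
  rewrite (_ : pre _ = [set - c / u] `*` setT).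
    by rewrite product_measure1E // [X in (X * _)%E]lebesgue_measure_set1 mul0e.
  apply/seteqP; split => -[x y] /=; rewrite E v0 mul0r addr0 /=.
    by move=> /eqP; rewrite addr_eq0 => /eqP H; split => //; rewrite -H mulrC mulKf.
  by move=> [-> _]; rewrite mulrC mulfVK // addNr.
apply: integral0_eq => x _ /=.
rewrite (_ : xsection _ _ = [set - (c + u * x) / v]) ?lebesgue_measure_set1 //.
apply/seteqP; split => y /=; rewrite xsectionE /= E /=.
  move=> H; rewrite -[y](mulKf v0) mulrC; congr (_ / _); lra.
by move=> ->; field.
Qed.

Lemma bary_gt0_interior (p : triangle_of R 2) w : nondeg_tri p ->
  (forall a, 0 < bary p a w) -> interior (hull p) w.
Proof.
move=> nd w0; apply/nbhs_frobP.
have b0 a : 0 < frob (bary_vec p a).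
  rewrite lt0r frob_ge0 andbT; apply: contra (bary_vec_neq0 nd a).
  by move=> /eqP/frob_eq0 ->.
exists (\big[Num.min/1]_a (bary p a w / frob (bary_vec p a))).
  by elim/big_ind : _ => // [a b|a _]; [rewrite lt_min => -> ->|rewrite divr_gt0].
move=> w' w'w; apply/(hullP nd) => a.
have : frob (w' - w) < bary p a w / frob (bary_vec p a).
  by apply: lt_le_trans w'w _; exact: bigmin_le.
rewrite ltr_pdivlMr // mulrC => /(le_lt_trans (bary_lip p a w w')).
by rewrite ltr_norml; lra.
Qed.

(** A common point where no barycentric coordinate of either triangle vanishes
    would be interior to both, so the overlap lies on six lines. *)
Lemma overlap_null (p q : triangle_of R 2) : nondeg_tri p -> nondeg_tri q ->
  interior (hull p) `&` interior (hull q) = set0 ->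
  mu (pre (hull p) `&` pre (hull q)) = 0.
Proof.
move=> ndp ndq pq0.
pose L (r : triangle_of R 2) (a : 'I_3) : set plane := pre [set w | bary r a w = 0].
pose lines r := L r 0 `|` (L r 1 `|` L r (1 + 1)).
have linesP r a z : bary r a (param z) = 0 -> lines r z.
  by move: a; apply: I3_ind => h; [left|right; left|right; right].
have lines0 r : nondeg_tri r -> mu.-negligible (lines r).
  by move=> ndr; apply: negligibleU; [|apply: negligibleU]; exact: line_null.
apply: measure_negligible; first by apply: measurableI; exact: measurable_hull.
apply: (negligibleS _ (negligibleU (lines0 p ndp) (lines0 q ndq))) => z [/= zp zq].
apply: contrapT => /not_orP[np nq].
have gt0 r : nondeg_tri r -> hull r (param z) -> ~ lines r z ->
    interior (hull r) (param z).
  move=> ndr /(hullP ndr) z0 nz; apply: bary_gt0_interior => // a.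
  by rewrite lt0r z0 andbT; apply/eqP => /linesP.
have : (interior (hull p) `&` interior (hull q)) (param z).
  by split; [exact: gt0|exact: gt0].
by rewrite pq0.
Qed.

Definition cont_on (D : set 'cV[R]_2) (h : 'cV[R]_2 -> R) : Prop :=
  forall w e, D w -> 0 < e -> exists2 r : R, 0 < r &
    forall w', D w' -> frob (w' - w) < r -> `|h w' - h w| < e.

(** The superlevel sets are traces on [D] of countable unions of boxes with
    rational centers and sizes. *)
Lemma measurable_cont_on (D : set 'cV[R]_2) (h : 'cV[R]_2 -> R) :
  measurable (pre D) -> cont_on D h -> measurable_fun (pre D) (h \o @param R).
Proof.
move=> mD hD; move=> _; apply: (measurability _ (RGenOInfty.measurableE R)) => //.
move=> _ [_ [c ->] <-].
pose box (q : rat * rat * rat) : set plane :=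
  `]ratr q.1.1 - ratr q.2, ratr q.1.1 + ratr q.2[%classic `*`
  `]ratr q.1.2 - ratr q.2, ratr q.1.2 + ratr q.2[%classic.
pose good := [set q | box q `&` pre D `<=` [set z | c < h (param z)]].
rewrite (_ : _ `&` _ = pre D `&` \bigcup_(q in good) box q); last first.
  apply/seteqP; split => z [Dz]; last first.
    by move=> [q gq qz]; split => //=; rewrite in_itv /= andbT; exact: gq.
  rewrite /= in_itv /= andbT => cz; split => //.
  have [|r r0 rh] := hD (param z) (h (param z) - c) Dz; first by rewrite subr_gt0.
  have r40 : 0 < r / 4 by rewrite divr_gt0.
  have [s] := rat_in_itvoo r40; rewrite in_itv /= => /andP[s0 sr].
  have rat_near (x : R) : exists q : rat, ratr q - ratr s < x /\ x < ratr q + ratr s.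
    have [|q] := @rat_in_itvoo R (x - ratr s) (x + ratr s); first by lra.
    by rewrite in_itv /= => /andP[? ?]; exists q; split; lra.
  have [q1 [q1a q1b]] := rat_near z.1; have [q2 [q2a q2b]] := rat_near z.2.
  exists (q1, q2, s); last by split; rewrite /= in_itv /=; apply/andP; split.
  move=> z' [[/=]]; rewrite !in_itv /= => /andP[a1 b1] /andP[a2 b2] Dz'.
  have : `|h (param z') - h (param z)| < h (param z) - c.
    apply: rh => //; apply: le_lt_trans (frob_le_sum_entries _) _.
    rewrite !big_ord_recl !big_ord0 !addr0 !mxE /=.
    have d1 : `|z'.1 - z.1| < r / 2 by rewrite ltr_norml; apply/andP; split; lra.
    have d2 : `|z'.2 - z.2| < r / 2 by rewrite ltr_norml; apply/andP; split; lra.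
    lra.
  by rewrite ltr_norml => /andP[? _]; lra.
apply: measurableI => //.
rewrite (_ : \bigcup_(q in good) box q =
    \bigcup_q (if q \in good then box q else set0)).
  apply: countable_bigcupT_measurable => [|q]; first exact: countableP.
  case: ifPn => _; last exact: measurable0.
  by apply: measurableX; exact: measurable_itv.
apply/seteqP; split => z [q].
  by move=> gq qz; exists q => //; rewrite mem_set.
by case: ifPn => [/set_mem gq _ qz|//]; exists q.
Qed.

End Plane.

(** * Surface integrals over a mesh *)

(** Making the union of the other sets disjoint from [F i] removes a null set
    only. *)
Lemma ge0_integral_bigsetU_null (d : measure_display) (T : measurableType d)
    (R : realType) (mu : {measure set T -> \bar R}) (I : eqType) (F : I -> set T)
    (f : T -> \bar R) (D : set T) (s : seq I) :
  (forall i, measurable (F i)) -> (forall i, F i `<=` D) -> measurable D ->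
  measurable_fun D f -> (forall z, D z -> (0 <= f z)%E) ->
  (forall i j, i != j -> mu (F i `&` F j) = 0) -> uniq s ->
  (\int[mu]_(z in \big[setU/set0]_(i <- s) F i) f z =
   \sum_(i <- s) \int[mu]_(z in F i) f z)%E.
Proof.
move=> mF FD mD mf f0 F0; elim: s => [|i s IHs] /= => [_|/andP[is_ /IHs {}IHs]].
  by rewrite !big_nil integral_set0.
rewrite !big_cons -IHs; set B := \big[setU/set0]_(j <- s) F j.
have mB : measurable B by apply: bigsetU_measurable.
have BD : B `<=` D.
  by rewrite /B; elim/big_ind : _ => // [C E CD ED z [/CD|/ED]].
have N0 : mu (F i `&` B) = 0.
  apply: measure_negligible; first exact: measurableI.
  have : {subset s <= [pred j | i != j]}.
    by move=> j js; rewrite inE; apply: contraNneq is_ => ->.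
  rewrite /B; clear B mB BD is_ IHs; elim: s => [_|j s IHs sP].
    by rewrite big_nil setI0; exact: negligible_set0.
  rewrite big_cons setIUr; apply: negligibleU.
    by apply/negligibleP; [exact: measurableI|apply: F0; apply: sP; exact: mem_head].
  by apply: IHs => k ks; apply: sP; rewrite inE ks orbT.
have -> : F i `|` B = F i `|` (B `\` (F i `&` B)).
  apply/seteqP; split => z [|]; [by left| |by left|by case; right].
  by move=> Bz; have [Fz|nFz] := pselect (F i z); [left|right; split => // -[]].
have mBD : measurable (B `\` (F i `&` B)) by apply: measurableD => //; exact: measurableI.
rewrite ge0_integral_setU //.
- by congr adde; rewrite [RHS](ge0_negligible_integral (N := F i `&` B)) //;
    [exact: measurableI|exact: (measurable_funS mD)|move=> z /BD; exact: f0].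
- by apply: (measurable_funS mD) => // z [/FD //|[/BD]].
- by move=> z [/FD|[/BD]]; [exact: f0|move=> Dz _; exact: f0].
- by apply/disj_setPRL => z [Bz nN] Fz; apply: nN.
Qed.

Section SurfaceIntegral.
Variables (R : realType) (m : nat) (Om : set 'cV[R]_2) (x : 'cV[R]_2 -> 'cV[R]_m).
Variables (CM : R) (K : mesh Om).
Hypothesis hx : simple_surface Om x CM.

Local Notation plane := (measurableTypeR R * measurableTypeR R)%type.
Local Notation mu := (@lebesgue_measure R \x @lebesgue_measure R)%E.
Local Notation pre D := (@param R @^-1` D : set plane).
Local Notation X := (jacobian_in Om x).
Local Notation sig := (sigma_max Om x).
Local Notation da := (area_element Om x).

Lemma pre_domain :
  pre Om = \big[setU/set0]_(t <- index_enum 'I_(ntri K)) pre (hull (tri K t)).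
Proof.
rewrite -bigcup_seq; apply/seteqP; split => z /=.
  by move=> /(mesh_cover K)[t tz]; exists t; rewrite //= mem_index_enum.
by move=> [t _]; exact: hull_sub.
Qed.

Lemma measurable_tri t : measurable (pre (hull (tri K t))).
Proof. exact: measurable_hull (tri_nondeg t). Qed.

Lemma measurable_domain : measurable (pre Om).
Proof. by rewrite pre_domain; apply: bigsetU_measurable => t _; exact: measurable_tri. Qed.

Lemma domain_finite_measure : (mu (pre Om) < +oo)%E.
Proof.
have [D D0 OmD] := domain_bounded K.
pose J := `[- D, D]%classic : set (measurableTypeR R).
have mJ : measurable J by exact: measurable_itv.
have sub : pre Om `<=` J `*` J.
  move=> z /OmD zD; have zi i : `|param z i 0| <= D.
    by apply: le_trans (entry_le_frob _ _ _) zD.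
  by split; rewrite /J /= in_itv /= -ler_norml; [have := zi 0|have := zi 1]; rewrite mxE.
have mJJ : measurable (J `*` J : set plane) by exact: measurableX.
have : (mu (pre Om) <= mu (J `*` J))%E.
  by apply: le_measure; rewrite ?inE //; exact: measurable_domain.
move=> /le_lt_trans; apply.
have JE : exists r : R, @lebesgue_measure R J = r%:E.
  by rewrite lebesgue_measure_itv /=; case: ifP => _; [exists (D - - D)|exists 0].
have JJE : mu (J `*` J) = (@lebesgue_measure R J * @lebesgue_measure R J)%E.
  exact: product_measure1E.
by have [r rE] := JE; rewrite JJE rE -EFinM ltry.
Qed.

Lemma measurable_surface_cont (k l : nat) (A : 'cV[R]_2 -> 'M[R]_(k, l)) i j (C : R) :
  (forall w w', Om w -> Om w' -> frob (A w - A w') <= C * frob (w - w')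
     + C * frob (x w - x w')) ->
  measurable_fun (pre Om) (fun z => A (param z) i j : measurableTypeR R).
Proof.
move=> AC; apply: (@measurable_cont_on _ Om (fun w => A w i j)).
  exact: measurable_domain.
move=> w e Omw e0; have [r r0 rP] := common_triangle K w.
have sig0 := sigma_max_ge0 K hx Omw.
have C0 : 0 < `|C| * (1 + sig) + 1 by rewrite ltr_wpDl // mulr_ge0 // addr_ge0.
exists (Num.min r (e / (`|C| * (1 + sig) + 1))).
  by rewrite lt_min r0 divr_gt0.
move=> w' Omw'; rewrite lt_min ltr_pdivlMr // => /andP[/(rP _ Omw')[t [tw tw']] w'w].
have xw := surface_lip_segment K hx (hull_segment_in tw tw').
have := entry_le_frob (A w' - A w) i j; rewrite !mxE => /le_lt_trans; apply.
apply: le_lt_trans (AC _ _ Omw' Omw) _; rewrite -mulrDr.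
have f0 := frob_ge0 (w' - w); have f1 := frob_ge0 (x w' - x w).
apply: (@le_lt_trans _ _ (`|C| * (frob (w' - w) + sig * frob (w' - w)))).
  apply: le_trans (ler_wpM2r (addr_ge0 f0 f1) (ler_norm C)) _.
  by rewrite ler_wpM2l // lerD2l.
apply: le_lt_trans w'w; rewrite [leRHS]mulrDr mulr1.
rewrite (_ : `|C| * _ = frob (w' - w) * (`|C| * (1 + sig))); [by rewrite lerDl|ring].
Qed.

Lemma measurable_jacobian i j :
  measurable_fun (pre Om) (fun z => X (param z) i j : measurableTypeR R).
Proof.
apply: (@measurable_surface_cont _ _ X i j `|CM|) => w w' Omw Omw'.
apply: le_trans (surface_lip hx Omw Omw') _.
apply: (@le_trans _ _ (`|CM| * frob (w - w'))).
  by rewrite ler_wpM2r ?frob_ge0 ?ler_norm.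
by rewrite lerDl mulr_ge0 ?frob_ge0.
Qed.

Lemma gram_entry (A : 'M[R]_(m, 2)) i j :
  (A^T *m A) i j = \sum_k A k i * A k j.
Proof. by rewrite mxE; apply: eq_bigr => k _; rewrite mxE. Qed.

Lemma measurable_area_element : measurable_fun (pre Om) (fun z => da (param z)).
Proof.
have -> : (fun z => da (param z)) = (@Num.sqrt R) \o
    (fun z => \sum_(s : 'S_2) (-1) ^+ s * \prod_i
       \sum_k X (param z) k i * X (param z) k (s i)).
  apply/funext => z; rewrite /= /area_element /determinant; congr Num.sqrt.
  apply: eq_bigr => s _; congr (_ * _); apply: eq_bigr => i _.
  exact: gram_entry.
apply: measurableT_comp; first by apply: continuous_measurable_fun; exact: sqrt_continuous.
apply: measurable_sum => s; apply: measurable_funM => //.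
apply: measurable_prod => i _; apply: measurable_sum => k.
by apply: measurable_funM; exact: measurable_jacobian.
Qed.

Lemma area_element_ge0 w : 0 <= da w.
Proof. exact: sqrtr_ge0. Qed.

Lemma area_element_bounded : exists2 C, 0 <= C & forall w, Om w -> da w <= C.
Proof.
exists (Num.sqrt (\sum_(s : 'S_2) \prod_(i < 2) sig ^+ 2)); first exact: sqrtr_ge0.
move=> w Omw; rewrite /area_element ler_wsqrtr //.
apply: le_trans (ler_norm _) _; apply: le_trans (ler_norm_sum _ _ _) _.
apply: ler_sum => s _; rewrite normrM normr_sign mul1r normr_prod.
apply: ler_prod => i _; rewrite normr_ge0 /=; apply: le_trans (entry_le_frob _ _ _) _.
apply: le_trans (frobM _ _) _; rewrite frob_tr expr2.
by apply: ler_pM; rewrite ?frob_ge0 ?(frob_jacobian_le K hx).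
Qed.

(** Everything is required on the domain only, as Jacobians are arbitrary
    outside it. *)
Definition density (h : 'cV[R]_2 -> R) : Prop :=
  [/\ forall w, Om w -> 0 <= h w, exists C, forall w, Om w -> h w <= C
    & measurable_fun (pre Om) (fun z => h (param z) : measurableTypeR R)].

Lemma density_cst (c : R) : 0 <= c -> density (fun=> c).
Proof. by move=> c0; split => //; exists c. Qed.

Lemma measurable_density h D : density h -> measurable (pre D) -> D `<=` Om ->
  measurable_fun (pre D) (fun z => (h (param z) * da (param z))%:E).
Proof.
move=> [_ _ mh] mD DOm; apply: (measurable_funS measurable_domain).
  by move=> z; exact: DOm.
apply/measurable_EFinP; apply: measurable_funM => //.
exact: measurable_area_element.
Qed.

Lemma density_ge0 h D : density h -> D `<=` Om ->
  forall z, pre D z -> (0 <= (h (param z) * da (param z))%:E)%E.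
Proof.
by move=> [h0 _ _] DOm z Dz; rewrite lee_fin mulr_ge0 ?area_element_ge0 ?h0 //; exact: DOm.
Qed.

Lemma surface_integral_ge0 h D : density h -> D `<=` Om ->
  (0 <= surface_integral Om x D h)%E.
Proof. by move=> dh DOm; apply: integral_ge0 => z; exact: (density_ge0 dh DOm). Qed.

Lemma surface_integral_fin h D : density h -> measurable (pre D) -> D `<=` Om ->
  surface_integral Om x D h \is a fin_num.
Proof.
move=> dh mD DOm; rewrite ge0_fin_numE; last exact: surface_integral_ge0.
have [h0 [C hC] _] := dh; have [A A0 daA] := area_element_bounded.
apply: (@le_lt_trans _ _ (\int[mu]_(z in pre D) cst (`|C| * A)%:E z)%E).
  apply: ge0_le_integral => //; [exact: density_ge0|exact: measurable_density|].
  move=> z Dz; have Omz := DOm _ Dz; rewrite lee_fin.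
  apply: ler_pM; rewrite ?h0 ?area_element_ge0 ?daA //.
  exact: le_trans (hC _ Omz) (ler_norm _).
rewrite integral_cst //; apply: (@le_lt_trans _ _ ((`|C| * A)%:E * mu (pre Om))%E).
  apply: lee_wpmul2l; first by rewrite lee_fin mulr_ge0.
  by apply: le_measure; rewrite ?inE //; [exact: measurable_domain|move=> z; exact: DOm].
have finOm : mu (pre Om) \is a fin_num.
  by rewrite ge0_fin_numE //; exact: domain_finite_measure.
by rewrite -(fineK finOm) -EFinM ltry.
Qed.

End SurfaceIntegral.

Section Energies.
Variables (R : realType) (m n : nat) (Om : set 'cV[R]_2) (x : 'cV[R]_2 -> 'cV[R]_m).
Variables (CM : R) (K : mesh Om) (N : set 'cV[R]_n) (CL : R).
Hypothesis hx : simple_surface Om x CM.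
Hypothesis CL_ge0 : 0 <= CL.

Local Notation plane := (measurableTypeR R * measurableTypeR R)%type.
Local Notation mu := (@lebesgue_measure R \x @lebesgue_measure R)%E.
Local Notation pre D := (@param R @^-1` D : set plane).
Local Notation adm := (admissible Om x N CL).
Local Notation G f := (tgrad Om x f).
Local Notation density := (density Om).

Definition sint (D : set 'cV[R]_2) (h : 'cV[R]_2 -> R) : R :=
  fine (surface_integral Om x D h).

Lemma sintE h D : density h -> measurable (pre D) -> D `<=` Om ->
  surface_integral Om x D h = (sint D h)%:E.
Proof. by move=> dh mD DOm; rewrite fineK // (surface_integral_fin K hx). Qed.

Lemma sint_domain h : density h -> sint Om h = \sum_t sint (hull (tri K t)) h.
Proof.
move=> dh; apply: EFin_inj; rewrite -sumEFin -sintE //; last exact: (measurable_domain K).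
have tE t : (sint (hull (tri K t)) h)%:E = surface_integral Om x (hull (tri K t)) h.
  by rewrite -sintE //; [exact: measurable_tri|exact: hull_sub].
rewrite (eq_bigr _ (fun t _ => tE t)).
rewrite {1}/surface_integral [X in integral mu X _](pre_domain K).
apply: (@ge0_integral_bigsetU_null _ _ _ mu _ _ _ (pre Om)) => //.
- by move=> t; exact: measurable_tri.
- by move=> t z; exact: hull_sub.
- exact: (measurable_domain K).
- exact: (measurable_density K hx dh (measurable_domain K) (@subset_refl _ _)).
- by move=> z; exact: (density_ge0 x dh (@subset_refl _ _)).
- by move=> s t st; apply: overlap_null; [exact: tri_nondeg..|exact: tri_nooverlap].
- exact: index_enum_uniq.
Qed.

Lemma sint_cst (c : R) D : 0 <= c -> measurable (pre D) -> D `<=` Om ->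
  sint D (fun=> c) = c * sint D (fun=> 1).
Proof.
move=> c0 mD DOm; apply: EFin_inj; rewrite EFinM -!sintE //;
  [|exact: density_cst..].
rewrite /surface_integral -ge0_integralZl ?lee_fin //.
- by apply: eq_integral => z _; rewrite mul1r EFinM.
- exact: (measurable_density K hx (density_cst Om ler01) mD DOm).
- by move=> z; exact: (density_ge0 x (density_cst Om ler01) DOm).
Qed.

Lemma sint_le h k (c : R) D : density h -> density k -> 0 <= c ->
  measurable (pre D) -> D `<=` Om -> (forall w, D w -> h w <= k w + c) ->
  sint D h <= sint D k + c * sint D (fun=> 1).
Proof.
move=> dh dk c0 mD DOm hk; rewrite -sint_cst // -lee_fin EFinD -!sintE //;
  last exact: density_cst.
have dc := density_cst Om c0.
have md l : density l -> measurable_fun (pre D)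
    (fun z => (l (param z) * area_element Om x (param z))%:E).
  by move=> dl; exact: (measurable_density K hx dl mD DOm).
have ge0 l : density l -> forall z, pre D z ->
    (0 <= (l (param z) * area_element Om x (param z))%:E)%E.
  by move=> dl z; exact: (density_ge0 x dl DOm).
rewrite /surface_integral -ge0_integralD //;
  [|exact: ge0|exact: md|exact: ge0|exact: md].
apply: ge0_le_integral => //; [exact: ge0|exact: md| |].
  by apply: emeasurable_funD; exact: md.
move=> z Dz; rewrite -EFinD lee_fin -mulrDl ler_wpM2r ?area_element_ge0 //.
exact: hk.
Qed.

Lemma tgrad_density f (B : R) : adm f -> (forall w, Om w -> frob (G f w) <= B) ->
  density (fun w => frob (G f w) ^+ 2).
Proof.
move=> fadm fB; split => [w _|| ]; first exact: sqr_ge0.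
  exists (B ^+ 2) => w Omw; rewrite ler_pXn2r ?nnegrE ?frob_ge0 ?fB //.
  exact: le_trans (frob_ge0 _) (fB _ Omw).
rewrite (_ : (fun _ => _) = fun z => \sum_i \sum_j G f (param z) i j ^+ 2); last first.
  by apply/funext => z; rewrite sqr_frob.
apply: measurable_sum => i; apply: measurable_sum => j; apply: measurable_funX.
apply: (@measurable_surface_cont _ _ _ _ _ K hx _ _ (G f) i j CL) => w w' Omw Omw'.
apply: le_trans (admissible_lip CL_ge0 fadm Omw Omw') _.
by rewrite lerDr mulr_ge0 ?frob_ge0.
Qed.

Lemma dirichletE f (B : R) : adm f -> (forall w, Om w -> frob (G f w) <= B) ->
  dirichlet Om x f = (2^-1 * \sum_t sint (hull (tri K t)) (fun w => frob (G f w) ^+ 2))%:E.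
Proof.
move=> fadm fB; have dG := tgrad_density fadm fB.
by rewrite /dirichlet -sint_domain // EFinM -sintE //; exact: (measurable_domain K).
Qed.

Definition discrete_density (t : 'I_(ntri K)) (f : 'cV[R]_m -> 'cV[R]_n) : R :=
  frob (vertex_values f (lift_tri x (tri K t)) *m
    (bary_mx (lift_tri x (tri K t)))^T) ^+ 2.

Lemma discrete_dirichletE f : discrete_dirichlet x K f =
  (2^-1 * \sum_t discrete_density t f * sint (hull (tri K t)) (fun=> 1))%:E.
Proof.
rewrite /discrete_dirichlet mulr_sumr -sumEFin; apply: eq_bigr => t _.
have q0 : 0 <= discrete_density t f by exact: sqr_ge0.
have mt := measurable_tri t.
have tOm := @hull_sub _ _ K t.
have H : surface_integral Om x (hull (tri K t)) (fun=> discrete_density t f) =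
    (discrete_density t f * sint (hull (tri K t)) (fun=> 1))%:E.
  by rewrite (sintE (density_cst Om q0) mt tOm) (sint_cst q0 mt tOm).
by rewrite EFinM -H.
Qed.

(** The errors of the triangles add up to a multiple of the area of the surface,
    which does not depend on the mesh. *)
Lemma energies_close f (B c : R) : adm f -> (forall w, Om w -> frob (G f w) <= B) ->
  0 <= c -> (forall t w, hull (tri K t) w ->
    `|discrete_density t f - frob (G f w) ^+ 2| <= c) ->
  exists e d : R, [/\ discrete_dirichlet x K f = e%:E, dirichlet Om x f = d%:E &
    `|e - d| <= c * sint Om (fun=> 1)].
Proof.
move=> fadm fB c0 fc; have dG := tgrad_density fadm fB.
have d1 : density (fun=> 1) by exact: density_cst.
rewrite discrete_dirichletE (dirichletE fadm fB); eexists; eexists; split; [by []|by []|].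
have close t : `|discrete_density t f * sint (hull (tri K t)) (fun=> 1)
    - sint (hull (tri K t)) (fun w => frob (G f w) ^+ 2)|
    <= c * sint (hull (tri K t)) (fun=> 1).
  have q0 : 0 <= discrete_density t f by exact: sqr_ge0.
  have mt := measurable_tri t; have tOm := @hull_sub _ _ K t.
  rewrite -sint_cst // ler_distlC; apply/andP; split.
    rewrite lerBlDr; apply: sint_le => //; first exact: density_cst.
    by move=> w /fc; rewrite ler_norml; lra.
  apply: sint_le => //; first exact: density_cst.
  by move=> w /fc; rewrite ler_norml; lra.
have s0 : 0 <= c * sint Om (fun=> 1).
  by rewrite mulr_ge0 // fine_ge0 // (surface_integral_ge0 x d1).
rewrite -mulrBr -sumrB normrM ger0_norm ?invr_ge0 //.
apply: le_trans (_ : 2^-1 * (c * sint Om (fun=> 1)) <= _); last by lra.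
rewrite ler_wpM2l ?invr_ge0 // sint_domain // mulr_sumr.
by apply: le_trans (ler_norm_sum _ _ _) _; apply: ler_sum => t _.
Qed.

Lemma discrete_minimizer : adm !=set0 ->
  exists2 f0, adm f0 & forall f, adm f ->
    (discrete_dirichlet x K f0 <= discrete_dirichlet x K f)%E.
Proof.
move=> adm0; pose e f := 2^-1 * \sum_t discrete_density t f *
  sint (hull (tri K t)) (fun=> 1).
have e0 f : 0 <= e f.
  rewrite mulr_ge0 ?invr_ge0 // sumr_ge0 // => t _.
  rewrite mulr_ge0 ?sqr_ge0 // fine_ge0 // surface_integral_ge0 //; last exact: hull_sub.
  exact: density_cst.
have [|f0 f0adm f0min] := admissible_minimizer K hx CL_ge0 adm0 e0.
  move=> U f0 UU f0lim.
  have qcvg t : discrete_density t f @[f --> U] --> discrete_density t f0.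
    set v := lift_tri x (tri K t).
    have Zlim : ulim U (fun f => vertex_values f v *m (bary_mx v)^T)
        (vertex_values f0 v *m (bary_mx v)^T).
      rewrite vertex_values_bary (_ : (fun _ => _) =
        fun f => \sum_a f (v a) *m (bary_vec v a)^T); last first.
        by apply/funext => f; rewrite vertex_values_bary.
      apply: ulim_sum => a; apply: ulim_mulr; apply: f0lim.
      exact: hull_sub (hull_vertex _ a).
    by have := cvgM (ulim_frob Zlim) (ulim_frob Zlim); exact.
  apply: cvgMr; apply: (cvg_big (op := +%R)) => [|t _]; first exact: add_continuous.
  by apply: cvgMl; exact: qcvg.
exists f0 => // f fadm; rewrite !discrete_dirichletE lee_fin; exact: f0min.
Qed.

End Energies.

(** * Convergence of the discrete minima *)

Theorem theorem4p1 (R : realType) (m n : nat) (hm : (2 <= m)%N)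
    (Om : set 'cV[R]_2) (x : 'cV[R]_2 -> 'cV[R]_m) (CM : R)
    (hx : simple_surface Om x CM)
    (N : set 'cV[R]_n) (CL : R) (hCL : 0 < CL)
    (hF : admissible Om x N CL !=set0)
    (I : Type) (K : I -> mesh Om)
    (hV : forall i t, nondeg_tri (lift_tri x (tri (K i) t)))
    (hpsi' : unif_to_0 K (psi' Om x CM))
    (hpsi'' : unif_to_0 K (psi'' Om x CL)) :
  exists minE : I -> \bar R,
    (forall i, is_minimum
       [set discrete_dirichlet x (K i) f | f in admissible Om x N CL]
       (minE i)) /\
    minE @ h_to_0 K -->
      ereal_inf [set dirichlet Om x f | f in admissible Om x N CL].
Proof.
set adm := admissible Om x N CL in hF *; set E := ereal_inf _.
have CL0 : 0 <= CL := ltW hCL.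
have /choice[f0 f0P] i : exists f, adm f /\ forall g, adm g ->
    (discrete_dirichlet x (K i) f <= discrete_dirichlet x (K i) g)%E.
  by have [f fadm fmin] := discrete_minimizer (K i) hx CL0 hF; exists f.
exists (fun i => discrete_dirichlet x (K i) (f0 i)); split => [i|].
  have [f0adm f0min] := f0P i; split; first by exists (f0 i).
  by move=> _ [f fadm <-]; exact: f0min.
have [[i0 _]|noI] := pselect (exists i : I, True); last first.
  (* Without any mesh every set belongs to the filter. *)
  by move=> A _; exists 1 => //= i; exfalso; apply: noI; exists i.
have [B B0 gradB] := admissible_tgrad_bounded (K i0) hx CL0 hF.
set S := sint Om x Om (fun=> 1).
(* [C * d] bounds the gap between the densities when [psi'] and [psi''] are below
   [d], see [discrete_density_close]. *)
pose C := (B + 1) * (3 * B + 1); have C0 : 0 < C.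
  by rewrite mulr_gt0 // ?ltr_wpDl ?mulr_ge0.
have S0 : 0 <= S.
  by rewrite fine_ge0 // (surface_integral_ge0 x (density_cst Om ler01)).
have close d : 0 < d -> d <= 1 -> \forall i \near h_to_0 K, forall f, adm f ->
    exists e r : R, [/\ discrete_dirichlet x (K i) f = e%:E,
      dirichlet Om x f = r%:E & `|e - r| <= C * d * S].
  move=> d0 d1; apply: filterS (filterI (hpsi' _ d0) (hpsi'' _ d0)) => i [ih' ih''] f fadm.
  apply: (energies_close (K := K i) hx CL0 fadm (B := B)).
  - by move=> w; exact: gradB.
  - by rewrite mulr_ge0 ?ltW.
  - move=> t w tw; have Omw := hull_sub tw.
    exact: (discrete_density_close hx CL0 fadm tw (hV i t) (gradB _ _ fadm Omw)
      (ih' t) (ih'' t) d1).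
have [r Er] : exists r : R, E = r%:E.
  have [g gadm] := hF.
  have Efin : E \is a fin_num.
    have dE := dirichletE (K i0) hx CL0 gadm (fun w => gradB g w gadm).
    rewrite ge0_fin_numE.
      apply: le_lt_trans (_ : E <= dirichlet Om x g)%E _; last by rewrite dE ltry.
      by apply: ereal_inf_lbound; exists g.
    apply/ereal_infP => _ [f fadm <-].
    rewrite mule_ge0 ?lee_fin ?invr_ge0 //.
    apply: surface_integral_ge0 => //.
    exact: (tgrad_density (K i0) hx CL0 fadm (fun w => gradB f w fadm)).
  by exists (fine E); rewrite fineK.
rewrite Er; apply/fine_cvgP; split.
  have := close 1 ltr01 (lexx _); apply: filterS => i /(_ _ (f0P i).1).
  by move=> [e [s [-> _ _]]].
apply/cvgrPdist_le => e e0.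
pose d := Num.min 1 (e / (C * S + 1)).
have CS0 : 0 < C * S + 1 by rewrite ltr_wpDl // mulr_ge0 // ltW.
have d0 : 0 < d by rewrite lt_min ltr01 divr_gt0.
have d1 : d <= 1 by rewrite ge_min lexx.
have dE : C * d * S <= e.
  have : d <= e / (C * S + 1) by rewrite ge_min lexx orbT.
  by rewrite ler_pdivlMr // mulrDr mulr1 (_ : C * d * S = d * (C * S)); [lra|ring].
have := close d d0 d1; apply: filterS => i iclose.
have [f0adm f0min] := f0P i.
have [e0i [r0i [eE rE er]]] := iclose _ f0adm.
rewrite /= eE /= ler_distlC; apply/andP; split.
  have : (E <= r0i%:E)%E by rewrite -rE; apply: ereal_inf_lbound; exists (f0 i).
  by rewrite Er lee_fin; move: er; rewrite ler_norml => /andP[? ?] ?; lra.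
have : ((e0i - e)%:E <= E)%E.
  apply/ereal_infP => _ [f fadm <-].
  have [ef [rf [efE -> erf]]] := iclose _ fadm; rewrite lee_fin.
  have := f0min _ fadm; rewrite eE efE lee_fin.
  by move: erf; rewrite ler_norml => /andP[? ?] ?; lra.
by rewrite Er lee_fin; lra.
Qed.
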